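(* Let $X$, $A$, $T(t,s)$, $\mu$, $\nu$, $P^1,P^2,P^3$, $D,\lambda,d$, $f$ and $c$ satisfy all the assumptions listed in the context. Assume that $$q:=c(2D+1)+2cD\lambda^{-1}<1.$$ Then there exists $C>0$ with the following property: for any $\delta>0$ and any differentiable map $y\colon[0,+\infty)\to X$ satisfying $$|y'(t)-A(t)y(t)-f(t,y(t))|\le \frac{\delta\,\mu'(t)}{\mu(t)\,\nu(t)^d}\quad\text{for all } t\ge 0,$$ there exists a differentiable map $x\colon[0,+\infty)\to X$ such that: (i) $P^3(t)(x(t)-y(t))=0$ for all $t\ge 0$; (ii) $\sup_{t\ge 0}|x(t)-y(t)|\le C\delta$; (iii) $x'(t)-A(t)x(t)-f(t,x(t))\in \operatorname{Im}P^3(t)$ for all $t\ge 0$; (iv) for all $t\ge 0$, $$|x'(t)-A(t)x(t)-f(t,x(t))|\le C\delta(2D+1)\,\nu(t)^d\max\Big\{1,\frac{\mu'(t)}{\mu(t)}\Big\}.$$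
   Context: $X=(X,|\cdot|)$ is an arbitrary Banach space, $\mathcal B(X)$ is the space of bounded linear operators on $X$ with operator norm $\|\cdot\|$, and $\mathbb I$ is the identity operator. $A\colon[0,+\infty)\to\mathcal B(X)$ is continuous, and $T(t,s)$, $t,s\ge 0$, denotes the evolution family of $x'=A(t)x$: for fixed $s\ge0$ and $v\in X$, $t\mapsto T(t,s)v$ is the solution of $x'=A(t)x$ on $[0,+\infty)$ with $x(s)=v$ (so $T(t,t)=\mathbb I$ and $T(t,s)T(s,r)=T(t,r)$ for all $t,s,r\ge 0$). $f\colon[0,+\infty)\times X\to X$ is continuous. $\mu\colon[0,+\infty)\to\mathbb R$ is strictly increasing and differentiable with $\mu(0)=1$ and $\lim_{t\to+\infty}\mu(t)=+\infty$. $\nu\colon[0,+\infty)\to[1,+\infty)$ is an arbitrary map. Assumptions: (1) there are three families of projections $P^i(t)$, $t\ge0$, $i\in\{1,2,3\}$, on $X$ with $P^1(t)+P^2(t)+P^3(t)=\mathbb I$ for $t\ge 0$; (2) $P^i(t)P^j(t)=0$ for $i\ne j$ and $t\ge 0$; (3) $T(t,s)P^i(s)=P^i(t)T(t,s)$ for all $t,s\ge 0$ and $i\in\{1,2,3\}$; (4) there exist $D,\lambda>0$ and $d\ge 0$ such that $$\|T(t,s)P^1(s)\|\le D\Big(\frac{\mu(t)}{\mu(s)}\Big)^{-\lambda}\nu(s)^d\ \text{ for } t\ge s,\qquad \|T(t,s)P^2(s)\|\le D\Big(\frac{\mu(s)}{\mu(t)}\Big)^{-\lambda}\nu(s)^d\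 \text{ for } t\le s;$$ (5) there exists $c\ge 0$ such that $$|f(t,x)-f(t,y)|\le\frac{c\,\mu'(t)}{\mu(t)\nu(t)^d}|x-y|\quad\text{for } t\ge 0 \text{ and } x,y\in X.$$ *)

(* Defs.v *)
From Stdlib Require Import Reals.
From Coquelicot Require Import Coquelicot.
Open Scope R_scope.

Inductive index3 : Set := i1 | i2 | i3.

(* [filterdiff] along the trace of the neighbourhoods of [t] on [0,+oo): at
   [t = 0] this is the right derivative, for [t > 0] the usual one.  Values of
   functions at negative times never matter. *)
Definition is_derive_nonneg {V : NormedModule R_AbsRing}
    (g : R -> V) (t : R) (l : V) : Prop :=
  filterdiff g (within (Rle 0) (locally t)) (fun h : R => scal h l).

(* Coquelicot's [is_linear] means linear and bounded; the supremum below is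
   finite exactly for bounded operators. *)
Definition opnorm {X : NormedModule R_AbsRing} (L : X -> X) : R :=
  real (Lub_Rbar (fun r => exists v : X, norm v <= 1 /\ r = norm (L v))).

Definition continuous_operators {X : NormedModule R_AbsRing}
    (A : R -> X -> X) : Prop :=
  (forall t, 0 <= t -> is_linear (A t)) /\
  (forall t, 0 <= t ->
     filterlim (fun s => opnorm (fun v => minus (A s v) (A t v)))
       (within (Rle 0) (locally t)) (locally 0)).

(* Uniqueness of solutions makes each [T t s] a bounded linear operator and
   gives [T t s (T s r v) = T t r v], so neither is required here. *)
Definition is_evolution_family {X : NormedModule R_AbsRing}
    (A : R -> X -> X) (T : R -> R -> X -> X) : Prop :=
  forall (s : R) (v : X), 0 <= s ->
    T s s v = v /\
    (forall t, 0 <= t ->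
       is_derive_nonneg (fun r => T r s v) t (A t (T t s v))).

Definition is_projection {X : NormedModule R_AbsRing} (P : X -> X) : Prop :=
  is_linear P /\ (forall v, P (P v) = P v).

(* Main.v *)
Require Import Defs.
From Stdlib Require Import Reals Lra List IndefiniteDescription.
From Coquelicot Require Import Coquelicot.
Import ListNotations.
Open Scope R_scope.

(** With x = y + z and the defect r = y' - A y - f(t, y + z), the requirements
    become z' = A z - (P1 + P2) r together with P3 z = 0, a fixed point problem for
    z on bounded continuous functions:
      z(t) = - int_0^t T(t,s) P1(s) r(s) ds + int_t^oo T(t,s) P2(s) r(s) ds.
    Since y' is an arbitrary derivative, these integrals need not exist in the
    sense of Riemann; instead T(0,s) r(s) has the explicit antiderivative
    K(t) = T(0,t) y(t) - int_0^t T(0,s) f(s, y + z) ds, so that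
      z(t) = T(t,0) [P1(0) (K(0) - K(t)) + lim_oo P2(0) K - P2(0) K(t)],
    and every integral estimate is replaced by the mean value inequality against
    the primitives of (mu(t)/mu(s))^(-lambda) mu'(s)/mu(s) and
    (mu(s)/mu(t))^(-lambda) mu'(s)/mu(s). The step map is then a contraction with
    constant 2 c D / lambda. *)

(** * Linear identities in a normed module *)

(** The third family of projections carries no growth estimate, so its part of the defect cannot be
    integrated to something bounded. It is left uncorrected and becomes the residual [P3(t) r(t)] of
    [x], whose size is governed by [|P3(t)| <= 1 + 2 D nu(t)^d]. The weights are matched to the
    dichotomy: the factor [nu(s)^d] lost there cancels the [nu(s)^(-d)] of the forcing, and [mu'/mu]
    turns each kernel into an exact derivative of total mass at most [1/lambda], uniformly in [t].
    Hence a forcing of weighted size [delta + c |z|] has a response of size at most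
    [(2 D / lambda) (delta + c |z|)], and equality in this bound fixes the radius [B delta] with [B
    = (2 D / lambda) / (1 - 2 c D / lambda)]. Projections at different times are compared through
    [P(s) = T(s,0) P(0) T(0,s)], so that derivatives only have to pass through the fixed bounded
    operators [P(0)]. *)

Inductive vexpr : Type :=
  | VZero | VAtom (n : nat) | VPlus (a b : vexpr) | VMinus (a b : vexpr)
  | VOpp (a : vexpr) | VScal (k : R) (a : vexpr).

Section LinearCombinations.

Context {V : NormedModule R_AbsRing}.

Fixpoint veval (env : list V) (e : vexpr) : V :=
  match e with
  | VZero => zero
  | VAtom n => nth n env zero
  | VPlus a b => plus (veval env a) (veval env b)
  | VMinus a b => minus (veval env a) (veval env b)
  | VOpp a => opp (veval env a)
  | VScal k a => scal k (veval env a)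
  end.

Fixpoint vcoef (e : vexpr) (i : nat) : R :=
  match e with
  | VZero => 0
  | VAtom n => if Nat.eqb n i then 1 else 0
  | VPlus a b => vcoef a i + vcoef b i
  | VMinus a b => vcoef a i - vcoef b i
  | VOpp a => - vcoef a i
  | VScal k a => k * vcoef a i
  end.

Fixpoint vcomb (env : list V) (c : nat -> R) : V :=
  match env with
  | [] => zero
  | v :: env' => plus (scal (c 0%nat) v) (vcomb env' (fun i => c (S i)))
  end.

(** A nested conjunction rather than a bounded quantifier, so that [simpl] and [split] leave one
    real equation per atom. *)
Fixpoint all_below (n : nat) (Q : nat -> Prop) : Prop :=
  match n with 0%nat => True | S n' => Q 0%nat /\ all_below n' (fun i => Q (S i)) end.

Lemma all_below_forall (n : nat) (Q : nat -> Prop) :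
  (forall i, Q i) -> all_below n Q.
Proof.
  revert Q; induction n as [|n IH]; intros Q H; simpl; auto.
Qed.

Lemma vcomb_ext (env : list V) (c c' : nat -> R) :
  all_below (length env) (fun i => c i = c' i) -> vcomb env c = vcomb env c'.
Proof.
  revert c c'; induction env as [|v env IH]; intros c c'; simpl; [easy|].
  intros [-> H]; now rewrite (IH _ _ H).
Qed.

Lemma vcomb_zero (env : list V) : vcomb env (fun _ => 0) = zero.
Proof.
  induction env as [|v env IH]; simpl; [easy|].
  rewrite IH, plus_zero_r; apply (@scal_zero_l R_AbsRing).
Qed.

Lemma vcomb_plus (env : list V) (c c' : nat -> R) :
  vcomb env (fun i => c i + c' i) = plus (vcomb env c) (vcomb env c').
Proof.
  revert c c'; induction env as [|v env IH]; intros c c'; simpl.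
  - now rewrite plus_zero_l.
  - rewrite IH.
    replace (scal (c 0%nat + c' 0%nat) v)
      with (plus (scal (c 0%nat) v) (scal (c' 0%nat) v))
      by (symmetry; apply (@scal_distr_r R_AbsRing)).
    rewrite <- !plus_assoc; f_equal; rewrite !plus_assoc; f_equal; apply plus_comm.
Qed.

Lemma vcomb_scal (env : list V) (k : R) (c : nat -> R) :
  vcomb env (fun i => k * c i) = scal k (vcomb env c).
Proof.
  revert c; induction env as [|v env IH]; intros c; simpl.
  - symmetry; apply (@scal_zero_r R_AbsRing).
  - rewrite IH, (@scal_distr_l R_AbsRing); f_equal.
    symmetry; apply (@scal_assoc R_AbsRing).
Qed.

Lemma vcomb_atom (env : list V) (n : nat) :
  vcomb env (fun i => if Nat.eqb n i then 1 else 0) = nth n env zero.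
Proof.
  revert n; induction env as [|v env IH]; intros [|n]; simpl; try easy.
  - rewrite vcomb_zero, plus_zero_r; apply (@scal_one R_AbsRing).
  - rewrite IH.
    replace (scal 0 v) with (@zero V) by (symmetry; apply (@scal_zero_l R_AbsRing)).
    apply plus_zero_l.
Qed.

Lemma veval_vcomb (env : list V) (e : vexpr) : veval env e = vcomb env (vcoef e).
Proof.
  induction e as [|n|a IHa b IHb|a IHa b IHb|a IHa|k a IHa]; simpl.
  - symmetry; apply vcomb_zero.
  - symmetry; apply vcomb_atom.
  - now rewrite vcomb_plus, IHa, IHb.
  - transitivity (vcomb env (fun i => vcoef a i + (-1) * vcoef b i)).
    + rewrite vcomb_plus, vcomb_scal, IHa, IHb.
      now rewrite (@scal_opp_one R_AbsRing V).
    + apply vcomb_ext, all_below_forall; intros i; ring.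
  - transitivity (vcomb env (fun i => (-1) * vcoef a i)).
    + rewrite vcomb_scal, IHa; symmetry; apply (@scal_opp_one R_AbsRing V).
    + apply vcomb_ext, all_below_forall; intros i; ring.
  - now rewrite vcomb_scal, IHa.
Qed.

(** The reflection step behind [vring]: a linear expression is determined by its coefficients, so an
    identity of vectors reduces to finitely many identities in R, which [ring] settles. *)
Lemma veval_eq (env : list V) (e e' : vexpr) :
  all_below (length env) (fun i => vcoef e i = vcoef e' i) ->
  veval env e = veval env e'.
Proof.
  intros H; rewrite !veval_vcomb; now apply vcomb_ext.
Qed.

End LinearCombinations.

Ltac vatom_index x env :=
  lazymatch env with
  | x :: _ => constr:(0%nat)
  | _ :: ?env' => let n := vatom_index x env' in constr:(S n)
  end.

(** The first branch is only a membership test: when [vatom_index] fails, [match] backtracks and the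
    new atom is added. *)
Ltac vatom_add x env :=
  match env with
  | _ => let n := vatom_index x env in env
  | _ => constr:(x :: env)
  end.

Ltac vatoms V t env :=
  lazymatch t with
  | zero => env
  | plus ?a ?b => let env' := vatoms V a env in vatoms V b env'
  | minus ?a ?b => let env' := vatoms V a env in vatoms V b env'
  | opp ?a => vatoms V a env
  | scal ?k ?a => vatoms V a env
  | _ => vatom_add t env
  end.

Ltac vreify env t :=
  lazymatch t with
  | zero => constr:(VZero)
  | plus ?a ?b =>
      let a' := vreify env a in let b' := vreify env b in constr:(VPlus a' b')
  | minus ?a ?b =>
      let a' := vreify env a in let b' := vreify env b in constr:(VMinus a' b')
  | opp ?a => let a' := vreify env a in constr:(VOpp a')
  | scal ?k ?a => let a' := vreify env a in constr:(VScal k a')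
  | _ => let n := vatom_index t env in constr:(VAtom n)
  end.

Tactic Notation "vring" constr(V) :=
  lazymatch goal with
  | |- ?l = ?r =>
      let env := vatoms V l constr:(@nil V) in
      let env := vatoms V r env in
      let l' := vreify env l in
      let r' := vreify env r in
      change (veval (V := V) env l' = veval (V := V) env r');
      apply veval_eq; simpl; repeat split; ring
  end.

(** * One-sided calculus on the half-line *)

(** Compactness of [[a, b]] in the form of Cousin's lemma: the supremum of the points reachable from
    [a] can always be passed unless it is [b]. It serves the mean value inequality, boundedness of
    continuous functions and the growth of solutions. *)
Lemma interval_induction (Q : R -> R -> Prop) (a b : R) :
  a <= b ->
  (forall u v w, a <= u <= v -> v <= w <= b -> Q u v -> Q v w -> Q u w) ->
  (forall t, a <= t <= b -> exists eta, 0 < eta /\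
     forall u v, a <= u <= t -> t <= v <= b -> v - u < eta -> Q u v) ->
  Q a b.
Proof.
  intros Hab Htrans Hloc.
  set (E := fun x => a <= x <= b /\ Q a x).
  assert (Ea : E a).
  { destruct (Hloc a) as (eta & Heta & H); [lra|].
    split; [lra | apply H; lra]. }
  destruct (completeness E) as (m & Hub & Hlub).
  - exists b; intros x [Hx _]; lra.
  - now exists a.
  - assert (Hm : a <= m <= b).
    { split; [now apply Hub | apply Hlub; intros x [Hx _]; lra]. }
    destruct (Hloc m Hm) as (eta & Heta & H).
    assert (Hx : exists x, E x /\ m - eta / 2 < x).
    { apply Classical_Prop.NNPP; intros Hn.
      enough (m <= m - eta / 2) by lra.
      apply Hlub; intros x Ex.
      destruct (Rle_lt_dec x (m - eta / 2)) as [|Hlt]; [easy|].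
      exfalso; eauto. }
    destruct Hx as (x & Ex & Hxm).
    assert (x <= m) by now apply Hub.
    destruct Ex as [Hx Qx].
    (* As [x > m - eta / 2], the interval from [x] to [v] is shorter than [eta] and contains [m];
       the new end [v] is [b] or lies beyond the supremum. *)
    set (v := Rmin b (m + eta / 4)).
    assert (Hv : m <= v <= b /\ v <= m + eta / 4 /\ (v = b \/ m < v)).
    { unfold v, Rmin; destruct (Rle_dec b (m + eta / 4)); repeat split; lra. }
    assert (Qv : Q a v).
    { apply (Htrans a x v); try lra; [easy|]. apply H; lra. }
    destruct Hv as (Hv & Hv' & [Hvb|Hmv]); [now rewrite Hvb in Qv|].
    assert (E v) by (split; [lra | easy]).
    assert (v <= m) by now apply Hub.
    lra.
Qed.

Lemma locally_nonneg_iff (t : R) (Q : R -> Prop) :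
  within (Rle 0) (locally t) Q <->
  exists eta, 0 < eta /\ forall s, 0 <= s -> Rabs (s - t) < eta -> Q s.
Proof.
  split.
  - intros [eta H]; exists eta; split; [apply cond_pos|].
    intros s Hs Hst; now apply H.
  - intros (eta & Heta & H); exists (mkposreal eta Heta).
    intros s Hst Hs; now apply H.
Qed.

Global Instance locally_nonneg_filter (t : R) :
  Filter (within (Rle 0) (locally t)).
Proof. apply within_filter, locally_filter. Qed.

Global Instance locally_nonneg_proper (t : R) :
  0 <= t -> ProperFilter (within (Rle 0) (locally t)).
Proof.
  intros Ht; constructor.
  - intros Q H; apply locally_nonneg_iff in H.
    destruct H as (eta & Heta & H).
    exists t; apply H; [easy|]; rewrite Rminus_diag, Rabs_R0; easy.
  - apply locally_nonneg_filter.
Qed.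

(** [filterdiff] quantifies over all limit points of the filter. For [0 <= t] the filter is proper,
    so [t] is the only one and the epsilon-eta form remains. *)
Lemma is_derive_nonneg_iff {V : NormedModule R_AbsRing}
    (g : R -> V) (t : R) (l : V) :
  0 <= t ->
  is_derive_nonneg g t l <->
  forall eps, 0 < eps -> exists eta, 0 < eta /\
    forall s, 0 <= s -> Rabs (s - t) < eta ->
      norm (minus (minus (g s) (g t)) (scal (s - t) l)) <= eps * Rabs (s - t).
Proof.
  intros Ht; split.
  - intros [_ H] eps Heps.
    assert (Hlim : is_filter_lim (within (Rle 0) (locally t)) t).
    { intros Q HQ; now apply filter_le_within. }
    specialize (H t Hlim (mkposreal eps Heps)).
    now apply locally_nonneg_iff in H.
  - intros H; split; [exact (@is_linear_scal_l R_AbsRing V l)|].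
    intros x Hx.
    assert (x = t) as ->.
    { apply (@is_filter_lim_unique R_AbsRing R_NormedModule
        (within (Rle 0) (locally t))
        (Proper_StrongProper _ (locally_nonneg_proper t Ht))); [exact Hx|].
      intros Q HQ; now apply filter_le_within. }
    intros eps; apply locally_nonneg_iff, (H eps), cond_pos.
Qed.

Lemma continuous_on_nonneg_iff {V : NormedModule R_AbsRing} (g : R -> V) :
  continuous_on (Rle 0) g <->
  forall t, 0 <= t -> forall eps, 0 < eps -> exists eta, 0 < eta /\
    forall s, 0 <= s -> Rabs (s - t) < eta -> norm (minus (g s) (g t)) <= eps.
Proof.
  split.
  - intros H t Ht eps Heps.
    specialize (H t Ht).
    apply (proj1 (filterlim_locally_ball_norm _ _)) with (eps := mkposreal eps Heps) in H.
    apply locally_nonneg_iff in H; destruct H as (eta & Heta & H).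
    exists eta; split; [easy|]; intros s Hs Hst; apply Rlt_le, H; easy.
  - intros H t Ht; apply filterlim_locally_ball_norm; intros eps.
    apply locally_nonneg_iff.
    destruct (H t Ht (eps / 2)) as (eta & Heta & Hs).
    { destruct eps; simpl; lra. }
    exists eta; split; [easy|]; intros s Hs' Hst.
    apply Rle_lt_trans with (eps / 2); [now apply Hs | destruct eps; simpl; lra].
Qed.

Section NormedModuleBasics.

Context {V : NormedModule R_AbsRing}.

Lemma norm_scal_le (k : R) (x : V) : norm (scal k x) <= Rabs k * norm x.
Proof. apply (@norm_scal R_AbsRing V). Qed.

Lemma norm_minus_zero_eq (x y : V) : norm (minus x y) = 0 -> x = y.
Proof.
  intros H; apply norm_eq_zero in H.
  transitivity (plus (minus x y) y); [vring V|].
  rewrite H; apply plus_zero_l.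
Qed.

Lemma norm_minus_diag (x : V) : norm (minus x x) = 0.
Proof.
  replace (minus x x) with (@zero V) by vring V; apply norm_zero.
Qed.

Lemma norm_minus_sym (x y : V) : norm (minus x y) = norm (minus y x).
Proof.
  rewrite <- norm_opp; f_equal; vring V.
Qed.

Lemma norm_minus_triangle (x y z : V) :
  norm (minus x z) <= norm (minus x y) + norm (minus y z).
Proof.
  replace (minus x z) with (plus (minus x y) (minus y z)) by vring V.
  apply norm_triangle.
Qed.

Lemma norm_le_plus_minus (x y : V) : norm x <= norm y + norm (minus x y).
Proof.
  replace x with (plus y (minus x y)) at 1 by vring V; apply norm_triangle.
Qed.

Lemma norm_minus_le (x y : V) : norm (minus x y) <= norm x + norm y.
Proof.
  unfold minus; rewrite <- (norm_opp y); apply norm_triangle.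
Qed.

Lemma norm_le_of_eps (x : V) (r : R) :
  (forall eps, 0 < eps -> norm x <= r + eps) -> norm x <= r.
Proof.
  intros H; apply le_epsilon; auto.
Qed.

Lemma is_derive_nonneg_continuous (g g' : R -> V) :
  (forall t, 0 <= t -> is_derive_nonneg g t (g' t)) ->
  continuous_on (Rle 0) g.
Proof.
  intros H; apply continuous_on_nonneg_iff; intros t Ht eps Heps.
  destruct (proj1 (is_derive_nonneg_iff g t _ Ht) (H t Ht) 1 Rlt_0_1)
    as (eta & Heta & Hd).
  set (L := norm (g' t)).
  assert (0 <= L) by apply norm_ge_0.
  assert (Hpos : 0 < eps / (L + 1)) by (apply Rdiv_lt_0_compat; lra).
  exists (Rmin eta (eps / (L + 1))); split; [now apply Rmin_glb_lt|].
  intros s Hs Hst.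
  assert (Hst1 := Rlt_le_trans _ _ _ Hst (Rmin_l _ _)).
  assert (Hst2 := Rlt_le_trans _ _ _ Hst (Rmin_r _ _)).
  eapply Rle_trans; [apply (norm_le_plus_minus _ (scal (s - t) (g' t)))|].
  eapply Rle_trans;
    [apply Rplus_le_compat; [apply norm_scal_le | now apply Hd]|]; fold L.
  replace eps with ((L + 1) * (eps / (L + 1))) by (field; lra).
  rewrite Rmult_comm, <- Rmult_plus_distr_r; apply Rmult_le_compat_l; lra.
Qed.

Lemma is_derive_nonneg_plus (g h : R -> V) (t : R) (g' h' : V) :
  is_derive_nonneg g t g' -> is_derive_nonneg h t h' ->
  is_derive_nonneg (fun s => plus (g s) (h s)) t (plus g' h').
Proof.
  intros Hg Hh.
  apply filterdiff_ext_lin with (fun k : R => plus (scal k g') (scal k h')).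
  - now apply (@filterdiff_plus_fct R_AbsRing R_NormedModule V
      (within (Rle 0) (locally t)) (locally_nonneg_filter t) g h).
  - intros k; vring V.
Qed.

Lemma is_derive_nonneg_minus (g h : R -> V) (t : R) (g' h' : V) :
  is_derive_nonneg g t g' -> is_derive_nonneg h t h' ->
  is_derive_nonneg (fun s => minus (g s) (h s)) t (minus g' h').
Proof.
  intros Hg Hh.
  apply filterdiff_ext_lin with (fun k : R => minus (scal k g') (scal k h')).
  - now apply (@filterdiff_minus_fct R_AbsRing R_NormedModule V
      (within (Rle 0) (locally t)) (locally_nonneg_filter t) g h).
  - intros k; vring V.
Qed.

Lemma is_derive_nonneg_scal (g : R -> V) (t k : R) (g' : V) :
  is_derive_nonneg g t g' ->
  is_derive_nonneg (fun s => scal k (g s)) t (scal k g').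
Proof.
  intros Hg.
  apply filterdiff_ext_lin with (fun j : R => scal k (scal j g')).
  - now apply (@filterdiff_scal_r_fct R_AbsRing R_NormedModule V
      (within (Rle 0) (locally t)) (locally_nonneg_filter t) k g
      _ Rmult_comm).
  - intros j; vring V.
Qed.

Lemma is_derive_nonneg_const (v : V) (t : R) :
  is_derive_nonneg (fun _ => v) t zero.
Proof.
  apply filterdiff_ext_lin with (fun _ : R => @zero V).
  - apply filterdiff_const.
  - intros k; vring V.
Qed.

Lemma is_derive_nonneg_ext (g h : R -> V) (t : R) (l : V) :
  0 <= t -> (forall s, 0 <= s -> g s = h s) ->
  is_derive_nonneg g t l -> is_derive_nonneg h t l.
Proof.
  intros Ht Hgh; rewrite !is_derive_nonneg_iff by easy.
  intros H eps Heps; destruct (H eps Heps) as (eta & Heta & Hs).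
  exists eta; split; [easy|]; intros s Hs0 Hst.
  rewrite <- !Hgh by easy; now apply Hs.
Qed.

Lemma is_derive_nonneg_linear (L : V -> V) (g : R -> V) (t : R) (l : V) :
  is_linear L -> 0 <= t ->
  is_derive_nonneg g t l -> is_derive_nonneg (fun s => L (g s)) t (L l).
Proof.
  intros HL Ht Hg.
  apply filterdiff_ext_lin with (fun k : R => L (scal k l)).
  - apply (@filterdiff_comp R_AbsRing R_NormedModule V V
      (within (Rle 0) (locally t)) (locally_nonneg_filter t) g L);
      [easy|].
    now apply filterdiff_linear.
  - intros k; exact (linear_scal L HL k l).
Qed.

(** Only difference quotients are compared, so the derivatives need not be
    integrable. *)
Lemma norm_increment_le (F F' : R -> V) (G G' : R -> R) (a b : R) :
  0 <= a <= b ->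
  (forall t, a <= t <= b -> is_derive_nonneg F t (F' t)) ->
  (forall t, a <= t <= b -> is_derive_nonneg G t (G' t)) ->
  (forall t, a <= t <= b -> norm (F' t) <= G' t) ->
  norm (minus (F b) (F a)) <= G b - G a.
Proof.
  intros Hab HF HG Hle.
  apply le_epsilon; intros e He.
  (* The [+ 1] keeps the denominator positive when [a = b]. *)
  set (eps := e / (b - a + 1)).
  assert (Heps : 0 < eps) by (apply Rdiv_lt_0_compat; lra).
  apply Rle_trans with (G b - G a + eps * (b - a)).
  2:{ apply Rplus_le_compat_l; unfold eps.
      apply Rmult_le_reg_r with (b - a + 1); [lra|].
      replace (e / (b - a + 1) * (b - a) * (b - a + 1)) with (e * (b - a))
        by (field; lra).
      apply Rmult_le_compat_l; lra. }
  (* With slack proportional to the length the inequality is additive over adjacent intervals.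
     Around a point [t] it follows by splitting there, half of the slack paying for the remainder of
     [F] and half for that of [G]. *)
  apply (interval_induction
    (fun u v => norm (minus (F v) (F u)) <= G v - G u + eps * (v - u))); [lra| |].
  - intros u v w Hu Hv H1 H2.
    eapply Rle_trans; [apply (norm_minus_triangle _ (F v))|]; lra.
  - intros t Ht.
    assert (Ht0 : 0 <= t) by lra.
    assert (Heps2 : 0 < eps / 2) by lra.
    destruct (proj1 (is_derive_nonneg_iff F t _ Ht0) (HF t Ht) _ Heps2)
      as (eta1 & Heta1 & H1).
    destruct (proj1 (is_derive_nonneg_iff G t _ Ht0) (HG t Ht) _ Heps2)
      as (eta2 & Heta2 & H2).
    assert (Hone : forall s, a <= s <= b -> Rabs (s - t) < Rmin eta1 eta2 ->
      norm (minus (F s) (F t)) <= Rabs (s - t) * (G' t + eps / 2) /\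
      Rabs (G s - G t - (s - t) * G' t) <= eps / 2 * Rabs (s - t)).
    { intros s Hs Hst.
      assert (Hst1 := Rlt_le_trans _ _ _ Hst (Rmin_l _ _)).
      assert (Hst2 := Rlt_le_trans _ _ _ Hst (Rmin_r _ _)).
      split; [| apply H2; [lra | easy]].
      eapply Rle_trans; [apply (norm_le_plus_minus _ (scal (s - t) (F' t)))|].
      assert (Hs0 : 0 <= s) by lra.
      specialize (H1 s Hs0 Hst1).
      assert (Hsc := norm_scal_le (s - t) (F' t)).
      assert (Rabs (s - t) * norm (F' t) <= Rabs (s - t) * G' t)
        by (apply Rmult_le_compat_l; [apply Rabs_pos | now apply Hle]).
      lra. }
    exists (Rmin eta1 eta2); split; [now apply Rmin_glb_lt|].
    intros u v Hu Hv Huv.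
    destruct (Hone u) as [Fu Gu]; [lra| rewrite Rabs_left1; lra|].
    destruct (Hone v) as [Fv Gv]; [lra| rewrite Rabs_pos_eq; lra|].
    rewrite Rabs_left1 in Fu by lra.
    rewrite (Rabs_left1 (u - t)) in Gu by lra.
    rewrite Rabs_pos_eq in Fv by lra.
    rewrite (Rabs_pos_eq (v - t)) in Gv by lra.
    apply Rabs_le_between in Gu; apply Rabs_le_between in Gv.
    eapply Rle_trans; [apply (norm_minus_triangle _ (F t))|].
    rewrite (norm_minus_sym (F t)).
    lra.
Qed.

End NormedModuleBasics.

(** * Linear equations and evolution families *)

Section LinearEquations.

Context {X : NormedModule R_AbsRing}.

Lemma norm_le_opnorm (L : X -> X) (v : X) :
  is_linear L -> norm (L v) <= opnorm L * norm v.
Proof.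
  intros HL; unfold opnorm.
  set (E := fun r => exists u : X, norm u <= 1 /\ r = norm (L u)).
  destruct (linear_norm L HL) as (M & HM & Hbound).
  destruct (Lub_Rbar_correct E) as [Hub Hlub].
  (* Boundedness of [L] keeps the supremum finite; on an infinite one [real] would return 0. *)
  assert (HltM : Rbar_le (Lub_Rbar E) M).
  { apply Hlub; intros r (u & Hu & ->); simpl.
    eapply Rle_trans; [apply Hbound|].
    rewrite <- (Rmult_1_r M) at 2; apply Rmult_le_compat_l; lra. }
  assert (Hfin : forall u : X, norm u <= 1 -> norm (L u) <= real (Lub_Rbar E)).
  { intros u Hu.
    assert (H : Rbar_le (norm (L u)) (Lub_Rbar E)) by (apply Hub; now exists u).
    now destruct (Lub_Rbar E). }
  destruct (Req_dec (norm v) 0) as [H0|H0].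
  - rewrite (norm_eq_zero v H0), (linear_zero L HL), norm_zero; lra.
  - assert (Hpos : 0 < norm v).
    { destruct (norm_ge_0 v) as [|E0]; [easy | now symmetry in E0]. }
    assert (Hunit : norm (scal (/ norm v) v) <= 1).
    { eapply Rle_trans; [apply norm_scal_le|].
      rewrite Rabs_pos_eq by (apply Rlt_le, Rinv_0_lt_compat, Hpos).
      right; now apply Rinv_l. }
    replace (L v) with (scal (norm v) (L (scal (/ norm v) v))).
    + eapply Rle_trans; [apply norm_scal_le|].
      rewrite (Rabs_pos_eq _ (norm_ge_0 v)), Rmult_comm.
      apply Rmult_le_compat_r; [apply norm_ge_0 | now apply Hfin].
    + rewrite <- (linear_scal L HL (norm v)); f_equal.
      transitivity (scal (norm v * / norm v) v); [vring X|].
      rewrite Rinv_r by easy; vring X.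
Qed.

Lemma is_linear_minus_fct (L L' : X -> X) :
  is_linear L -> is_linear L' -> is_linear (fun v => minus (L v) (L' v)).
Proof.
  intros HL HL'; split.
  - intros u v; rewrite (linear_plus L HL), (linear_plus L' HL'); vring X.
  - intros k v; rewrite (linear_scal L HL), (linear_scal L' HL'); vring X.
  - destruct (linear_norm L HL) as (M & HM & H).
    destruct (linear_norm L' HL') as (M' & HM' & H').
    exists (M + M'); split; [lra|]; intros v.
    eapply Rle_trans; [apply norm_minus_le|].
    rewrite Rmult_plus_distr_r; now apply Rplus_le_compat.
Qed.

Lemma continuous_operators_locally_bounded (A : R -> X -> X) (t : R) :
  continuous_operators A -> 0 <= t ->
  exists eta M, 0 < eta /\ 0 < M /\
    forall s, 0 <= s -> Rabs (s - t) < eta -> forall v, norm (A s v) <= M * norm v.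
Proof.
  intros [Hlin Hcont] Ht.
  destruct (linear_norm _ (Hlin t Ht)) as (M & HM & Hbound).
  specialize (Hcont t Ht).
  apply (proj1 (filterlim_locally _ _)) with (eps := mkposreal 1 Rlt_0_1) in Hcont.
  apply locally_nonneg_iff in Hcont; destruct Hcont as (eta & Heta & H).
  exists eta, (M + 1); repeat split; [easy | lra |]; intros s Hs Hst v.
  specialize (H s Hs Hst).
  change (Rabs (opnorm (fun v => minus (A s v) (A t v)) - 0) < 1) in H.
  rewrite Rminus_0_r in H; apply Rabs_lt_between in H.
  assert (Hop := norm_le_opnorm _ v
    (is_linear_minus_fct _ _ (Hlin s Hs) (Hlin t Ht))).
  simpl in Hop.
  eapply Rle_trans; [apply (norm_le_plus_minus _ (A t v))|].
  rewrite Rmult_plus_distr_r; apply Rplus_le_compat; [apply Hbound|].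
  eapply Rle_trans; [apply Hop|].
  apply Rmult_le_compat_r; [apply norm_ge_0 | lra].
Qed.

Lemma continuous_on_nonneg_bounded (g : R -> X) (b : R) :
  continuous_on (Rle 0) g -> 0 <= b ->
  exists M, forall t, 0 <= t <= b -> norm (g t) <= M.
Proof.
  intros Hg Hb; pose proof (proj1 (continuous_on_nonneg_iff g) Hg) as Hg'.
  apply (interval_induction
    (fun u v => exists M, forall t, u <= t <= v -> norm (g t) <= M)); [easy| |].
  - intros u v w _ _ [M H] [M' H']; exists (Rmax M M'); intros t Ht.
    destruct (Rle_dec t v).
    + eapply Rle_trans; [apply H; lra | apply Rmax_l].
    + eapply Rle_trans; [apply H'; lra | apply Rmax_r].
  - intros t Ht; destruct (Hg' t (proj1 Ht) 1 Rlt_0_1) as (eta & Heta & H).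
    exists eta; split; [easy|]; intros u v Hu Hv Huv.
    exists (norm (g t) + 1); intros s Hs.
    eapply Rle_trans; [apply (norm_le_plus_minus _ (g t))|].
    apply Rplus_le_compat_l, H; [lra|].
    apply Rabs_lt_between; lra.
Qed.

Lemma interval_distance_mult_le (u v p s M : R) :
  u <= s <= v -> u <= p <= v -> 0 <= M -> M * Rabs (p - s) <= M * (v - u).
Proof.
  intros Hs Hp HM; apply Rmult_le_compat_l; [easy|].
  apply Rabs_le_between; lra.
Qed.

Lemma norm_increment_le_const (F F' : R -> X) (B u v p s : R) :
  0 <= u -> u <= s <= v -> u <= p <= v ->
  (forall t, u <= t <= v -> is_derive_nonneg F t (F' t)) ->
  (forall t, u <= t <= v -> norm (F' t) <= B) ->
  norm (minus (F p) (F s)) <= B * Rabs (p - s).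
Proof.
  intros Hu Hs Hp HF HB.
  assert (HG : forall t : R, is_derive_nonneg (fun r => B * r) t B).
  { intros t; apply (filterdiff_ext_lin _ (fun k : R => scal B k)).
    - apply (filterdiff_linear (fun k : R => scal B k)).
      apply (@is_linear_scal_r R_AbsRing R_NormedModule B Rmult_comm).
    - intros k; apply Rmult_comm. }
  destruct (Rle_dec s p) as [Hsp|Hsp].
  - rewrite Rabs_pos_eq, Rmult_minus_distr_l by lra.
    apply (norm_increment_le F F' (fun r => B * r) (fun _ => B)); try lra; intros t Ht.
    + apply HF; lra.
    + apply HG.
    + apply HB; lra.
  - rewrite norm_minus_sym, Rabs_left1, Ropp_minus_distr, Rmult_minus_distr_l by lra.
    apply (norm_increment_le F F' (fun r => B * r) (fun _ => B)); try lra; intros t Ht.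
    + apply HF; lra.
    + apply HG.
    + apply HB; lra.
Qed.

(** On a short interval a solution at most doubles, uniformly in the solution
    and in both directions of time; chaining replaces Gronwall's inequality. *)
Lemma solution_growth (A : R -> X -> X) (b : R) :
  continuous_operators A -> 0 <= b ->
  exists K, 0 < K /\ forall x : R -> X,
    (forall t, 0 <= t -> is_derive_nonneg x t (A t (x t))) ->
    forall s t, 0 <= s <= b -> 0 <= t <= b -> norm (x t) <= K * norm (x s).
Proof.
  intros HA Hb.
  apply (interval_induction (fun u v => exists K, 0 < K /\ forall x : R -> X,
    (forall t, 0 <= t -> is_derive_nonneg x t (A t (x t))) ->
    forall s t, u <= s <= v -> u <= t <= v -> norm (x t) <= K * norm (x s)));
    [easy| |].
  - intros u v w Hu Hv (K & HK & H) (K' & HK' & H').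
    (* One constant for all positions of [s] and [t] relative to [v]: the product when [v] separates
       them, a single factor otherwise. *)
    exists (Rmax (K * K') (Rmax K K')).
    assert (H1 := Rmax_l (K * K') (Rmax K K')).
    assert (H2 := Rmax_r (K * K') (Rmax K K')).
    assert (H3 := Rmax_l K K'); assert (H4 := Rmax_r K K').
    assert (0 < K * K') by now apply Rmult_lt_0_compat.
    split; [lra|]; intros x Hx s t Hs Ht.
    assert (Hle : forall k, norm (x t) <= k * norm (x s) ->
      k <= Rmax (K * K') (Rmax K K') ->
      norm (x t) <= Rmax (K * K') (Rmax K K') * norm (x s)).
    { intros k Hk Hk'; eapply Rle_trans; [exact Hk|].
      apply Rmult_le_compat_r; [apply norm_ge_0 | easy]. }
    destruct (Rle_dec s v); destruct (Rle_dec t v).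
    + apply (Hle K); [apply H | ]; easy || lra.
    + apply (Hle (K * K')); [|lra].
      rewrite (Rmult_comm K), Rmult_assoc.
      eapply Rle_trans; [apply (H' x Hx v); lra|].
      apply Rmult_le_compat_l; [lra | apply H; easy || lra].
    + apply (Hle (K * K')); [|lra].
      rewrite Rmult_assoc.
      eapply Rle_trans; [apply (H x Hx v); lra|].
      apply Rmult_le_compat_l; [lra | apply H'; easy || lra].
    + apply (Hle K'); [apply H' | ]; easy || lra.
  - intros r Hr.
    destruct (continuous_operators_locally_bounded A r HA (proj1 Hr))
      as (eta & M & Heta & HM & Hbound).
    assert (HM2 : 0 < / (2 * M)) by (apply Rinv_0_lt_compat; lra).
    (* On length below [/ (2 * M)] the mean value inequality moves [x] by at most half of its
       supremum [S], so [S <= norm (x s) + S / 2], which is where the factor 2 comes from. *)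
    exists (Rmin eta (/ (2 * M))); split; [now apply Rmin_glb_lt|].
    intros u v Hu Hv Huv.
    assert (Huv1 := Rlt_le_trans _ _ _ Huv (Rmin_l _ _)).
    assert (Huv2 := Rlt_le_trans _ _ _ Huv (Rmin_r _ _)).
    exists 2; split; [lra|]; intros x Hx s t Hs Ht.
    assert (Hcx : continuous_on (Rle 0) x)
      by exact (is_derive_nonneg_continuous _ _ Hx).
    destruct (continuous_on_nonneg_bounded x v Hcx) as [B HB]; [lra|].
    (* The supremum must be known to be finite before half of it can be absorbed; this is the role
       of [B]. *)
    set (E := fun y => exists p, u <= p <= v /\ y = norm (x p)).
    destruct (completeness E) as (S & Hub & Hlub).
    + exists B; intros y (p & Hp & ->); apply HB; lra.
    + now exists (norm (x t)), t.
    + assert (HS : forall p, u <= p <= v -> norm (x p) <= S).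
      { intros p Hp; apply Hub; now exists p. }
      assert (HS0 : 0 <= S)
        by exact (Rle_trans _ _ _ (norm_ge_0 (x t)) (HS t Ht)).
      assert (HMS : 0 <= M * S) by (apply Rmult_le_pos; lra).
      assert (Hhalf : M * S * (v - u) <= S / 2).
      { replace (S / 2) with (M * S * / (2 * M)) by (field; lra).
        apply Rmult_le_compat_l; lra. }
      enough (S <= norm (x s) + S / 2) by (specialize (HS t Ht); lra).
      apply Hlub; intros y (p & Hp & ->).
      eapply Rle_trans; [apply (norm_le_plus_minus _ (x s))|].
      apply Rplus_le_compat_l.
      eapply Rle_trans; [|exact Hhalf].
      eapply Rle_trans;
        [|now apply (interval_distance_mult_le u v p s)].
      apply (norm_increment_le_const x (fun q => A q (x q)) _ u v);
        [lra | easy | easy | |].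
      * intros q Hq; apply Hx; lra.
      * intros q Hq.
        assert (Hqr : norm (A q (x q)) <= M * norm (x q)).
        { apply Hbound; [lra|]; apply Rabs_lt_between; lra. }
        eapply Rle_trans; [exact Hqr|].
        apply Rmult_le_compat_l; [lra | now apply HS].
Qed.

(** By linearity the difference of two solutions is a solution; it vanishes at [s], so the growth
    bound makes it vanish at every time, earlier or later. *)
Lemma solution_unique (A : R -> X -> X) (x y : R -> X) (s t : R) :
  continuous_operators A -> 0 <= s -> 0 <= t ->
  (forall r, 0 <= r -> is_derive_nonneg x r (A r (x r))) ->
  (forall r, 0 <= r -> is_derive_nonneg y r (A r (y r))) ->
  x s = y s -> x t = y t.
Proof.
  intros HA Hs Ht Hx Hy Hxy.
  destruct (solution_growth A (Rmax s t) HA) as (K & HK & H).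
  { eapply Rle_trans; [exact Hs | apply Rmax_l]. }
  assert (Hst1 := Rmax_l s t); assert (Hst2 := Rmax_r s t).
  apply norm_minus_zero_eq, Rle_antisym; [|apply norm_ge_0].
  replace 0 with (K * norm (minus (x s) (y s))).
  - apply (H (fun r => minus (x r) (y r))); [|lra|lra].
    intros r Hr.
    rewrite (linear_minus _ (x r) (y r) (proj1 HA r Hr)).
    now apply is_derive_nonneg_minus; [apply Hx | apply Hy].
  - rewrite Hxy, norm_minus_diag; ring.
Qed.

End LinearEquations.

Section EvolutionFamily.

Context {X : NormedModule R_AbsRing}.
Variables (A : R -> X -> X) (T : R -> R -> X -> X).
Hypothesis HA : continuous_operators A.
Hypothesis HT : is_evolution_family A T.

Lemma evolution_id (s : R) (v : X) : 0 <= s -> T s s v = v.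
Proof. intros Hs; apply (HT s v Hs). Qed.

Lemma evolution_derive (s t : R) (v : X) :
  0 <= s -> 0 <= t -> is_derive_nonneg (fun r => T r s v) t (A t (T t s v)).
Proof. intros Hs Ht; now apply (HT s v Hs). Qed.

Lemma evolution_bounded (b : R) :
  0 <= b ->
  exists K, 0 < K /\ forall s t v, 0 <= s <= b -> 0 <= t <= b ->
    norm (T t s v) <= K * norm v.
Proof.
  intros Hb; destruct (solution_growth A b HA Hb) as (K & HK & H).
  exists K; split; [easy|]; intros s t v Hs Ht.
  rewrite <- (evolution_id s v) at 2 by easy.
  apply (H (fun r => T r s v)); try easy.
  intros r Hr; apply evolution_derive; easy.
Qed.

(** Both sides of each algebraic identity solve the same equation and agree at time [s], so
    uniqueness applies; [evolution_comp] is obtained in the same way. *)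
Lemma evolution_linear (t s : R) : 0 <= t -> 0 <= s -> is_linear (T t s).
Proof.
  intros Ht Hs; split.
  - intros u v.
    apply (solution_unique A (fun r => T r s (plus u v))
      (fun r => plus (T r s u) (T r s v)) s t HA); try easy.
    + intros r Hr; now apply evolution_derive.
    + intros r Hr; rewrite (linear_plus _ (proj1 HA r Hr)).
      now apply is_derive_nonneg_plus; apply evolution_derive.
    + now rewrite !evolution_id.
  - intros k v.
    apply (solution_unique A (fun r => T r s (scal k v))
      (fun r => scal k (T r s v)) s t HA); try easy.
    + intros r Hr; now apply evolution_derive.
    + intros r Hr; rewrite (linear_scal _ (proj1 HA r Hr)).
      now apply is_derive_nonneg_scal; apply evolution_derive.
    + now rewrite !evolution_id.
  - assert (H1 := Rmax_l s t); assert (H2 := Rmax_r s t).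
    destruct (evolution_bounded (Rmax s t)) as (K & HK & H); [lra|].
    exists K; split; [easy|]; intros v; apply H; lra.
Qed.

Lemma evolution_comp (t s r : R) (v : X) :
  0 <= t -> 0 <= s -> 0 <= r -> T t s (T s r v) = T t r v.
Proof.
  intros Ht Hs Hr.
  apply (solution_unique A (fun q => T q s (T s r v)) (fun q => T q r v) s t HA);
    try easy.
  - intros q Hq; now apply evolution_derive.
  - intros q Hq; now apply evolution_derive.
  - now apply evolution_id.
Qed.

End EvolutionFamily.

(** * Product rule, chain rule, primitives and limits on the half-line *)

(** Product rule for an operator family that is controlled only vector by vector. The increment
    splits into that of [B] at the fixed vector [u t] and [B s (u s - u t)]; in the latter the local
    bound [K] absorbs the remainder of [u], and continuity of [B s u'] replaces [B s u'] by
    [B t u']. *)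
Lemma is_derive_nonneg_apply {X : NormedModule R_AbsRing}
    (B : R -> X -> X) (u : R -> X) (t : R) (u' a : X) :
  0 <= t ->
  (forall s, 0 <= s -> is_linear (B s)) ->
  (exists K, 0 < K /\ forall s v, 0 <= s <= t + 1 -> norm (B s v) <= K * norm v) ->
  continuous_on (Rle 0) (fun s => B s u') ->
  is_derive_nonneg (fun s => B s (u t)) t a ->
  is_derive_nonneg u t u' ->
  is_derive_nonneg (fun s => B s (u s)) t (plus a (B t u')).
Proof.
  intros Ht Hlin (K & HK & Hbound) Hcont Ha Hu.
  rewrite is_derive_nonneg_iff in Ha, Hu |- * by easy.
  rewrite continuous_on_nonneg_iff in Hcont.
  intros eps Heps.
  destruct (Ha (eps / 3)) as (eta1 & Heta1 & H1); [lra|].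
  destruct (Hu (eps / 3 / K)) as (eta2 & Heta2 & H2);
    [apply Rdiv_lt_0_compat; lra|].
  destruct (Hcont t Ht (eps / 3)) as (eta3 & Heta3 & H3); [lra|].
  exists (Rmin (Rmin eta1 eta2) (Rmin eta3 1)); split;
    [repeat apply Rmin_glb_lt; lra|].
  intros s Hs Hst.
  assert (Hst1 := Rlt_le_trans _ _ _ Hst (Rmin_l _ _)).
  assert (Hst2 := Rlt_le_trans _ _ _ Hst (Rmin_r _ _)).
  assert (Ha' := H1 s Hs (Rlt_le_trans _ _ _ Hst1 (Rmin_l _ _))).
  assert (Hu' := H2 s Hs (Rlt_le_trans _ _ _ Hst1 (Rmin_r _ _))).
  assert (Hc' := H3 s Hs (Rlt_le_trans _ _ _ Hst2 (Rmin_l _ _))).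
  assert (Hs1 : s <= t + 1).
  { assert (H := Rlt_le_trans _ _ _ Hst2 (Rmin_r _ _)).
    apply Rabs_lt_between in H; lra. }
  clear H1 H2 H3.
  set (rest := minus (minus (u s) (u t)) (scal (s - t) u')) in Hu'.
  assert (HB : norm (B s rest) <= eps / 3 * Rabs (s - t)).
  { eapply Rle_trans; [apply Hbound; lra|].
    replace (eps / 3 * Rabs (s - t)) with (K * (eps / 3 / K * Rabs (s - t)))
      by (field; lra).
    apply Rmult_le_compat_l; lra. }
  replace (minus (minus (B s (u s)) (B t (u t))) (scal (s - t) (plus a (B t u'))))
    with (plus (plus (minus (minus (B s (u t)) (B t (u t))) (scal (s - t) a))
                     (B s rest))
               (scal (s - t) (minus (B s u') (B t u')))).
  2:{ unfold rest.
      rewrite !(linear_minus _ _ _ (Hlin s Hs)), (linear_scal _ (Hlin s Hs)).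
      vring X. }
  eapply Rle_trans; [apply norm_triangle|].
  eapply Rle_trans; [apply Rplus_le_compat; [apply norm_triangle | apply norm_scal_le]|].
  assert (Rabs (s - t) * norm (minus (B s u') (B t u')) <= Rabs (s - t) * (eps / 3))
    by (apply Rmult_le_compat_l; [apply Rabs_pos | easy]).
  lra.
Qed.

Lemma is_derive_nonneg_comp_real (phi g : R -> R) (t l g' : R) :
  0 <= t -> is_derive phi (g t) l -> is_derive_nonneg g t g' ->
  is_derive_nonneg (fun s => phi (g s)) t (g' * l).
Proof.
  intros Ht Hphi Hg.
  set (F := within (Rle 0) (locally t)).
  assert (FF : ProperFilter F) by now apply locally_nonneg_proper.
  assert (Hlim : filterlim g F (locally (g t))).
  { apply (@filterdiff_continuous_aux R_AbsRing R_NormedModule R_NormedModule F _ g).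
    - now exists (fun h => scal h g').
    - intros Q HQ; now apply filter_le_within. }
  apply (filterdiff_ext_lin _ (fun k : R => scal (scal k g') l)).
  - apply (@filterdiff_comp R_AbsRing R_NormedModule R_NormedModule R_NormedModule
      F _ g phi (fun h => scal h g') (fun h => scal h l)); [easy|].
    apply (@filterdiff_locally R_AbsRing R_NormedModule R_NormedModule
      (filtermap g F) _ phi (g t)); easy.
  - intros k; apply Rmult_assoc.
Qed.

(** Precomposition with [Rmax 0] extends [h] to negative times by the constant [h 0]. The integrand
    is then continuous on all of R, and the two-sided fundamental theorem can be restricted to the
    half-line. *)
Lemma is_derive_nonneg_RInt {X : CompleteNormedModule R_AbsRing}
    (h : R -> X) (t : R) :
  0 <= t -> continuous_on (Rle 0) h ->
  is_derive_nonneg (fun b => RInt (fun s => h (Rmax 0 s)) 0 b) t (h t).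
Proof.
  intros Ht Hh.
  assert (Hcont : forall s, continuous (fun s => h (Rmax 0 s)) s).
  { assert (He := proj1 (continuous_on_nonneg_iff h) Hh).
    intros s.
    apply (proj2 (filterlim_locally_ball_norm (U := X) (fun r => h (Rmax 0 r)) _)).
    intros eps.
    assert (Heps : 0 < eps / 2) by (destruct eps; simpl; lra).
    destruct (He (Rmax 0 s) (Rmax_l _ _) _ Heps) as (eta & Heta & H).
    exists (mkposreal eta Heta); intros r Hr.
    apply Rle_lt_trans with (eps / 2); [|destruct eps; simpl in *; lra].
    apply H; [apply Rmax_l|].
    apply Rabs_lt_between in Hr; apply Rabs_lt_between; revert Hr; simpl.
    unfold minus, plus, opp, Rmax; simpl.
    destruct (Rle_dec 0 r), (Rle_dec 0 s); lra. }
  replace (h t) with (h (Rmax 0 t)) by now rewrite Rmax_right.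
  assert (Hd := is_derive_RInt (fun s => h (Rmax 0 s))
    (fun b => RInt (fun s => h (Rmax 0 s)) 0 b) 0 t).
  apply (@filterdiff_locally R_AbsRing R_NormedModule X
    (within (Rle 0) (locally t)) (locally_nonneg_proper t Ht) _ t).
  - intros Q HQ; now apply filter_le_within.
  - apply Hd; [|apply Hcont].
    apply filter_forall; intros b.
    apply (@RInt_correct X), ex_RInt_continuous; intros s _; apply Hcont.
Qed.

Definition limit_at_infty {X : CompleteNormedModule R_AbsRing} (g : R -> X) : X :=
  iota (is_filter_lim (filtermap g (Rbar_locally p_infty))).

(** Completeness turns the Cauchy condition into a limit, and [iota] returns that limit because it
    is unique. *)
Lemma limit_at_infty_spec {X : CompleteNormedModule R_AbsRing} (g : R -> X) :
  (forall eps, 0 < eps -> exists M, forall s t, M < s -> s <= t ->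
     norm (minus (g t) (g s)) <= eps) ->
  forall eps, 0 < eps -> exists M, forall t, M < t ->
    norm (minus (g t) (limit_at_infty g)) <= eps.
Proof.
  intros Hg.
  destruct (proj1 (filterlim_locally_cauchy (F := Rbar_locally p_infty) g))
    as [l Hl].
  - intros eps.
    assert (Heps : 0 < eps / 2) by (destruct eps; simpl; lra).
    destruct (Hg _ Heps) as [M HM].
    exists (fun s => M < s); split; [now exists M|].
    intros u v Hu Hv; apply (@norm_compat1 R_AbsRing X).
    apply Rle_lt_trans with (eps / 2); [|destruct eps; simpl in *; lra].
    destruct (Rle_dec u v); [|rewrite norm_minus_sym]; apply HM; lra.
  - assert (E : limit_at_infty g = l).
    { exact (@iota_is_filter_lim R_AbsRing X (filtermap g (Rbar_locally p_infty))
        _ l Hl). }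
    rewrite E; clear E.
    intros eps Heps.
    apply (proj1 (filterlim_locally_ball_norm (U := X) _ _)) with (eps := mkposreal eps Heps)
      in Hl.
    destruct Hl as [M HM]; exists M; intros t Ht; apply Rlt_le, (HM t Ht).
Qed.

(** * Banach's contraction principle for functions on the half-line *)

Section ContractionPrinciple.

Context {X : CompleteNormedModule R_AbsRing}.
Local Notation E := (CompleteNormedModule.NormedModule R_AbsRing X).

Lemma geometric_cauchy_limit (u : nat -> E) (k r : R) :
  0 <= k < 1 -> 0 <= r ->
  (forall n, norm (minus (u (S n)) (u n)) <= r * k ^ n) ->
  exists l, forall n, norm (minus (u n) l) <= r / (1 - k) * k ^ n.
Proof.
  intros Hk Hr Hu.
  set (B := r / (1 - k)).
  assert (HB : B * (1 - k) = r) by (unfold B; field; lra).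
  assert (HB0 : 0 <= B) by (apply Rdiv_le_0_compat; lra).
  assert (Hpow : forall n, 0 <= k ^ n) by (intros n; apply pow_le; lra).
  (* The exact partial geometric sum, rather than [B * k ^ n], is what the induction on [m] carries
     through. *)
  assert (Hsum : forall n m, norm (minus (u (n + m)%nat) (u n)) <= B * (k ^ n - k ^ (n + m))).
  { intros n m; induction m as [|m IH].
    - rewrite Nat.add_0_r, norm_minus_diag; lra.
    - rewrite Nat.add_succ_r.
      eapply Rle_trans; [apply (norm_minus_triangle _ (u (n + m)%nat))|].
      eapply Rle_trans; [apply Rplus_le_compat; [apply Hu | exact IH]|].
      right; rewrite <- HB; simpl; ring. }
  assert (Hle : forall n m, norm (minus (u (n + m)%nat) (u n)) <= B * k ^ n).
  { intros n m; eapply Rle_trans; [apply Hsum|].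
    apply Rmult_le_compat_l; [easy|]; specialize (Hpow (n + m)%nat); lra. }
  destruct (proj1 (filterlim_locally_cauchy (U := X) (F := eventually) u)) as [l Hl].
  - intros eps.
    destruct (pow_lt_1_zero k) with (y := eps / 2 / (B + 1)) as [N HN].
    + rewrite Rabs_pos_eq; lra.
    + apply Rdiv_lt_0_compat; [destruct eps; simpl|]; lra.
    + assert (HBN : B * k ^ N < eps / 2).
      { specialize (HN N (le_n N)); rewrite Rabs_pos_eq in HN by easy.
        apply Rle_lt_trans with ((B + 1) * k ^ N).
        - apply Rmult_le_compat_r; [easy | lra].
        - apply (Rmult_lt_compat_l (B + 1)) in HN; [|lra].
          eapply Rlt_le_trans; [exact HN|]; right; field; lra. }
      exists (fun n => (N <= n)%nat); split; [now exists N|].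
      intros n m Hn Hm; apply (@norm_compat1 R_AbsRing X).
      eapply Rle_lt_trans; [apply (norm_minus_triangle _ (u N))|].
      rewrite (norm_minus_sym (u N)).
      assert (H1 := Hle N (n - N)%nat); assert (H2 := Hle N (m - N)%nat).
      rewrite (Nat.add_comm N), Nat.sub_add in H1, H2 by easy.
      lra.
  - exists l; intros n; apply le_epsilon; intros eps Heps.
    apply (proj1 (filterlim_locally_ball_norm (U := X) _ _)) with (eps := mkposreal eps Heps)
      in Hl.
    destruct Hl as [N HN]; specialize (HN (n + N)%nat (Nat.le_add_l _ _)).
    eapply Rle_trans; [apply (norm_minus_triangle _ (u (n + N)%nat))|].
    rewrite (norm_minus_sym (u n)).
    apply Rplus_le_compat; [apply Hle | apply Rlt_le, HN].
Qed.

(** Functions are compared on [0 <= t] only and through arbitrary uniform bounds [rho], which avoids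
    building a function space with a supremum norm. The predicate [adm] stands for a closed
    invariant subset of it. *)
Lemma contraction_fixed_point
    (adm : (R -> E) -> Prop) (Phi : (R -> E) -> R -> E) (z0 : R -> E) (k r : R) :
  0 <= k < 1 -> 0 <= r ->
  adm z0 -> (forall z, adm z -> adm (Phi z)) ->
  (forall (u : nat -> R -> E) (z : R -> E), (forall n, adm (u n)) ->
     (forall eps, 0 < eps -> exists n, forall t, 0 <= t ->
        norm (minus (u n t) (z t)) <= eps) -> adm z) ->
  (forall t, 0 <= t -> norm (minus (Phi z0 t) (z0 t)) <= r) ->
  (forall z w rho, adm z -> adm w ->
     (forall t, 0 <= t -> norm (minus (z t) (w t)) <= rho) ->
     forall t, 0 <= t -> norm (minus (Phi z t) (Phi w t)) <= k * rho) ->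
  exists z, adm z /\ forall t, 0 <= t -> Phi z t = z t.
Proof.
  intros Hk Hr Hz0 Hstable Hclosed Hstart Hcontr.
  set (u := fun n => Nat.iter n Phi z0).
  assert (Hu : forall n, adm (u n)).
  { intros n; induction n; simpl; auto. }
  assert (Hstep : forall n t, 0 <= t ->
    norm (minus (u (S n) t) (u n t)) <= r * k ^ n).
  { intros n; induction n as [|n IH]; intros t Ht.
    - rewrite Rmult_1_r; now apply Hstart.
    - replace (r * k ^ S n) with (k * (r * k ^ n)) by (simpl; ring).
      exact (Hcontr (u (S n)) (u n) _ (Hu _) (Hu _) IH t Ht). }
  assert (Hlim : forall t, exists l, 0 <= t ->
    forall n, norm (minus (u n t) l) <= r / (1 - k) * k ^ n).
  { intros t; destruct (Rle_dec 0 t) as [Ht|]; [|now exists zero].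
    destruct (geometric_cauchy_limit (fun n => u n t) k r Hk Hr) as [l Hl].
    - intros n; now apply Hstep.
    - now exists l. }
  (* Choice assembles the pointwise limits into a function. Their rate does not depend on [t], so
     the convergence is uniform on the half-line. *)
  destruct (functional_choice _ Hlim) as [z Hz].
  set (B := r / (1 - k)) in Hz.
  assert (HB0 : 0 <= B) by (apply Rdiv_le_0_compat; lra).
  assert (Hunif : forall eps, 0 < eps -> exists N, forall n t, (N <= n)%nat ->
    0 <= t -> norm (minus (u n t) (z t)) <= eps).
  { intros eps Heps.
    destruct (pow_lt_1_zero k) with (y := eps / (B + 1)) as [N HN].
    - rewrite Rabs_pos_eq; lra.
    - apply Rdiv_lt_0_compat; lra.
    - exists N; intros n t Hn Ht; eapply Rle_trans; [now apply Hz|].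
      specialize (HN n Hn).
      assert (0 <= k ^ n) by (apply pow_le; lra).
      rewrite Rabs_pos_eq in HN by easy.
      replace eps with ((B + 1) * (eps / (B + 1))) by (field; lra).
      apply Rmult_le_compat; lra. }
  exists z.
  assert (Hadm : adm z).
  { apply (Hclosed u z Hu); intros eps Heps.
    destruct (Hunif eps Heps) as [N HN]; exists N; intros t; now apply HN. }
  split; [easy|]; intros t Ht.
  apply norm_minus_zero_eq, Rle_antisym; [|apply norm_ge_0].
  apply le_epsilon; intros eps Heps.
  destruct (Hunif (eps / 2)) as [N HN]; [lra|].
  assert (H1 : norm (minus (Phi z t) (u (S N) t)) <= k * (eps / 2)).
  { apply (Hcontr z (u N)); try easy.
    intros s Hs; rewrite norm_minus_sym; now apply HN. }
  assert (H2 := HN (S N) t (Nat.le_succ_diag_r N) Ht).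
  eapply Rle_trans; [apply (norm_minus_triangle _ (u (S N) t))|].
  assert (k * (eps / 2) <= 1 * (eps / 2)) by (apply Rmult_le_compat_r; lra).
  lra.
Qed.

End ContractionPrinciple.

(** * Transport of curves to time 0 and back *)

Section EvolutionFamilyDerivatives.

Context {X : NormedModule R_AbsRing}.
Variables (A : R -> X -> X) (T : R -> R -> X -> X).
Hypothesis HA : continuous_operators A.
Hypothesis HT : is_evolution_family A T.

(** The equation only governs the first time argument. The identity
    [T 0 s v - T 0 t v = T 0 s (v - T s t v)] and a local bound on [T 0 s] carry continuity over to
    the second. *)
Lemma evolution_continuous_initial_time (v : X) :
  continuous_on (Rle 0) (fun s => T 0 s v).
Proof.
  apply continuous_on_nonneg_iff; intros t Ht eps Heps.
  destruct (evolution_bounded A T HA HT (t + 1)) as (K & HK & Hbound); [lra|].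
  assert (Hc := is_derive_nonneg_continuous (fun s => T s t v) _
    (fun s Hs => evolution_derive A T HT t s v Ht Hs)).
  rewrite continuous_on_nonneg_iff in Hc.
  destruct (Hc t Ht (eps / K)) as (eta & Heta & H);
    [now apply Rdiv_lt_0_compat|].
  exists (Rmin eta 1); split; [apply Rmin_glb_lt; lra|]; intros s Hs Hst.
  assert (Hst1 := Rlt_le_trans _ _ _ Hst (Rmin_l _ _)).
  assert (Hst2 := Rlt_le_trans _ _ _ Hst (Rmin_r _ _)).
  apply Rabs_lt_between in Hst2.
  specialize (H s Hs Hst1).
  rewrite (evolution_id A T HT t v Ht) in H.
  rewrite <- (evolution_comp A T HA HT 0 s t v) by lra.
  rewrite <- (linear_minus _ _ _ (evolution_linear A T HA HT 0 s (Rle_refl 0) Hs)).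
  eapply Rle_trans; [apply Hbound; lra|].
  replace eps with (K * (eps / K)) by (field; lra).
  rewrite norm_minus_sym; apply Rmult_le_compat_l; lra.
Qed.

(** The difference quotient of [T 0 s (y s)] is [T 0 s] applied to that of
    [y s - T s t (y t)], so only the time-forward equation is needed. *)
Lemma evolution_pullback_derive (y : R -> X) (t : R) (y' : X) :
  0 <= t -> is_derive_nonneg y t y' ->
  is_derive_nonneg (fun s => T 0 s (y s)) t (T 0 t (minus y' (A t (y t)))).
Proof.
  intros Ht Hy.
  set (g := fun s => minus (y s) (T s t (y t))).
  assert (Hg0 : g t = zero).
  { unfold g; rewrite (evolution_id A T HT) by easy; vring X. }
  assert (Hlin : forall s, 0 <= s -> is_linear (T 0 s)).
  { intros s Hs; apply (evolution_linear A T HA HT); lra. }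
  assert (Hg : is_derive_nonneg g t (minus y' (A t (y t)))).
  { apply is_derive_nonneg_minus; [easy|].
    assert (H := evolution_derive A T HT t t (y t) Ht Ht).
    now rewrite (evolution_id A T HT) in H. }
  assert (H := is_derive_nonneg_apply (T 0) g t (minus y' (A t (y t))) zero Ht Hlin).
  assert (Hd : is_derive_nonneg (fun s => T 0 s (g s)) t
    (plus zero (T 0 t (minus y' (A t (y t)))))).
  { apply H.
    - destruct (evolution_bounded A T HA HT (t + 1)) as (K & HK & Hbound); [lra|].
      exists K; split; [easy|]; intros s v Hs; apply Hbound; lra.
    - apply evolution_continuous_initial_time.
    - apply (is_derive_nonneg_ext (fun _ => zero)); [easy| |apply is_derive_nonneg_const].
      intros s Hs; rewrite Hg0; symmetry; now apply linear_zero, Hlin.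
    - exact Hg. }
  apply (is_derive_nonneg_ext (fun s => plus (T 0 s (g s)) (T 0 t (y t)))); [easy| |].
  - intros s Hs; unfold g; rewrite (linear_minus _ _ _ (Hlin s Hs)).
    rewrite (evolution_comp A T HA HT) by lra; vring X.
  - replace (T 0 t (minus y' (A t (y t))))
      with (plus (plus zero (T 0 t (minus y' (A t (y t))))) zero) by vring X.
    apply is_derive_nonneg_plus; [easy | apply is_derive_nonneg_const].
Qed.

Lemma evolution_pushforward_derive (u : R -> X) (t : R) (u' : X) :
  0 <= t -> is_derive_nonneg u t u' ->
  is_derive_nonneg (fun s => T s 0 (u s)) t
    (plus (A t (T t 0 (u t))) (T t 0 u')).
Proof.
  intros Ht Hu.
  apply (is_derive_nonneg_apply (fun s => T s 0)); try easy.
  - intros s Hs; apply (evolution_linear A T HA HT); lra.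
  - destruct (evolution_bounded A T HA HT (t + 1)) as (K & HK & Hbound); [lra|].
    exists K; split; [easy|]; intros s v Hs; apply Hbound; lra.
  - apply (is_derive_nonneg_continuous (fun s => T s 0 u')
      (fun s => A s (T s 0 u'))).
    intros s Hs; apply (evolution_derive A T HT); lra.
  - apply (evolution_derive A T HT); lra.
Qed.

Lemma evolution_pullback_continuous (g : R -> X) :
  continuous_on (Rle 0) g -> continuous_on (Rle 0) (fun s => T 0 s (g s)).
Proof.
  intros Hg; rewrite continuous_on_nonneg_iff in Hg |- *; intros t Ht eps Heps.
  destruct (evolution_bounded A T HA HT (t + 1)) as (K & HK & Hbound); [lra|].
  destruct (Hg t Ht (eps / 2 / K)) as (eta1 & Heta1 & H1);
    [apply Rdiv_lt_0_compat; lra|].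
  destruct (proj1 (continuous_on_nonneg_iff _)
    (evolution_continuous_initial_time (g t)) t Ht (eps / 2))
    as (eta2 & Heta2 & H2); [lra|].
  exists (Rmin (Rmin eta1 eta2) 1); split; [repeat apply Rmin_glb_lt; lra|].
  intros s Hs Hst.
  assert (Hst1 := Rlt_le_trans _ _ _ Hst (Rmin_l _ _)).
  assert (Hst2 := Rlt_le_trans _ _ _ Hst (Rmin_r _ _)).
  apply Rabs_lt_between in Hst2.
  assert (Hg' := H1 s Hs (Rlt_le_trans _ _ _ Hst1 (Rmin_l _ _))).
  assert (HT' := H2 s Hs (Rlt_le_trans _ _ _ Hst1 (Rmin_r _ _))).
  eapply Rle_trans; [apply (norm_minus_triangle _ (T 0 s (g t)))|].
  replace eps with (K * (eps / 2 / K) + eps / 2) by (field; lra).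
  apply Rplus_le_compat; [|easy].
  rewrite <- (linear_minus _ _ _ (evolution_linear A T HA HT 0 s (Rle_refl 0) Hs)).
  eapply Rle_trans; [apply Hbound; lra|].
  apply Rmult_le_compat_l; lra.
Qed.

End EvolutionFamilyDerivatives.

(** * Dichotomy estimates and the correction *)

Lemma is_linear_comp_fct {X : NormedModule R_AbsRing} (L L' : X -> X) :
  is_linear L -> is_linear L' -> is_linear (fun v => L (L' v)).
Proof. intros HL HL'; exact (is_linear_comp L' L HL' HL). Qed.

Lemma Rpower_pos (x y : R) : 0 < Rpower x y.
Proof. apply exp_pos. Qed.

Lemma Rpower_one_l (y : R) : Rpower 1 y = 1.
Proof. unfold Rpower; now rewrite ln_1, Rmult_0_r, exp_0. Qed.

Lemma is_derive_nonneg_scal_real (g : R -> R) (t k g' : R) :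
  is_derive_nonneg g t g' -> is_derive_nonneg (fun s => k * g s) t (k * g').
Proof. exact (is_derive_nonneg_scal g t k g'). Qed.

Section Dichotomy.

Context {X : CompleteNormedModule R_AbsRing}.
Local Notation E := (CompleteNormedModule.NormedModule R_AbsRing X).

Variables (A : R -> E -> E) (T : R -> R -> E -> E) (mu mu' nu : R -> R)
  (P : index3 -> R -> E -> E) (D lambda d : R).
Hypotheses
  (HA : continuous_operators A)
  (HT : is_evolution_family A T)
  (Hmu_incr : forall s t, 0 <= s -> s < t -> mu s < mu t)
  (Hmu_deriv : forall t, 0 <= t -> is_derive_nonneg mu t (mu' t))
  (Hmu_0 : mu 0 = 1)
  (Hmu_lim : is_lim mu p_infty p_infty)
  (HP_proj : forall i t, 0 <= t -> is_projection (P i t))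
  (HP_sum : forall t v, 0 <= t ->
     plus (plus (P i1 t v) (P i2 t v)) (P i3 t v) = v)
  (HP_orth : forall i j t v, 0 <= t -> i <> j -> P i t (P j t v) = zero)
  (HP_inv : forall i t s v, 0 <= t -> 0 <= s ->
     T t s (P i s v) = P i t (T t s v))
  (HD : 0 < D) (Hlambda : 0 < lambda)
  (Hdich1 : forall t s, 0 <= s -> s <= t ->
     opnorm (fun v => T t s (P i1 s v))
       <= D * Rpower (mu t / mu s) (- lambda) * Rpower (nu s) d)
  (Hdich2 : forall t s, 0 <= t -> t <= s ->
     opnorm (fun v => T t s (P i2 s v))
       <= D * Rpower (mu s / mu t) (- lambda) * Rpower (nu s) d).

Lemma mu_pos (t : R) : 0 <= t -> 0 < mu t.
Proof.
  intros [Ht|<-]; [|lra].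
  specialize (Hmu_incr 0 t (Rle_refl 0) Ht); lra.
Qed.

Lemma projection_linear (i : index3) (t : R) : 0 <= t -> is_linear (P i t).
Proof. intros Ht; apply HP_proj, Ht. Qed.

Lemma evolution_projection_linear (i : index3) (t s : R) :
  0 <= t -> 0 <= s -> is_linear (fun v => T t s (P i s v)).
Proof.
  intros Ht Hs; apply is_linear_comp_fct.
  - now apply (evolution_linear A T HA HT).
  - now apply projection_linear.
Qed.

(** Invariance makes [P i s] conjugate to [P i 0]. This lets the response be written with
    projections at time 0 and estimated with the dichotomy at time [s]. *)
Lemma evolution_projection_pullback (i : index3) (t s : R) (v : E) :
  0 <= t -> 0 <= s -> T t 0 (P i 0 (T 0 s v)) = T t s (P i s v).
Proof.
  intros Ht Hs; rewrite <- HP_inv by lra.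
  apply (evolution_comp A T HA HT); lra.
Qed.

Lemma stable_bound (t s : R) (v : E) : 0 <= s <= t ->
  norm (T t s (P i1 s v))
    <= D * Rpower (mu t / mu s) (- lambda) * Rpower (nu s) d * norm v.
Proof.
  intros Hst.
  eapply Rle_trans;
    [apply (norm_le_opnorm (fun v => T t s (P i1 s v)));
     apply evolution_projection_linear; lra|].
  apply Rmult_le_compat_r; [apply norm_ge_0 | now apply Hdich1].
Qed.

Lemma unstable_bound (t s : R) (v : E) : 0 <= t <= s ->
  norm (T t s (P i2 s v))
    <= D * Rpower (mu s / mu t) (- lambda) * Rpower (nu s) d * norm v.
Proof.
  intros Hst.
  eapply Rle_trans;
    [apply (norm_le_opnorm (fun v => T t s (P i2 s v)));
     apply evolution_projection_linear; lra|].
  apply Rmult_le_compat_r; [apply norm_ge_0 | now apply Hdich2].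
Qed.

(** At equal times the dichotomy bounds [P1] and [P2] themselves by [D nu^d], and [P3] is the
    identity minus both. *)
Lemma center_projection_bound (t : R) (v : E) : 0 <= t ->
  norm (P i3 t v) <= (1 + 2 * D * Rpower (nu t) d) * norm v.
Proof.
  intros Ht.
  assert (H1 := stable_bound t t v); assert (H2 := unstable_bound t t v).
  rewrite !(evolution_id A T HT) in H1, H2 by easy.
  rewrite Rdiv_diag, Rpower_one_l, Rmult_1_r in H1, H2
    by (apply Rgt_not_eq, mu_pos, Ht).
  replace (P i3 t v) with (minus v (plus (P i1 t v) (P i2 t v))).
  2:{ rewrite <- (HP_sum t v Ht) at 1; vring E. }
  eapply Rle_trans; [apply norm_minus_le|].
  assert (H3 := norm_triangle (P i1 t v) (P i2 t v)).
  specialize (H1 (conj Ht (Rle_refl t))); specialize (H2 (conj Ht (Rle_refl t))).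
  lra.
Qed.

Lemma stable_weight_derive (t s : R) : 0 <= t -> 0 <= s ->
  is_derive_nonneg (fun r => / lambda * Rpower (mu t / mu r) (- lambda)) s
    (Rpower (mu t / mu s) (- lambda) * (mu' s / mu s)).
Proof.
  intros Ht Hs.
  assert (H1 := mu_pos t Ht); assert (H2 := mu_pos s Hs).
  replace (Rpower (mu t / mu s) (- lambda) * (mu' s / mu s))
    with (mu' s * (Rpower (mu t / mu s) (- lambda) / mu s)) by (field; lra).
  apply (is_derive_nonneg_comp_real
    (fun m => / lambda * Rpower (mu t / m) (- lambda)) mu); [easy| |now apply Hmu_deriv].
  unfold Rpower; auto_derive.
  - repeat split; [lra | now apply Rdiv_lt_0_compat].
  - unfold Rdiv; field; lra.
Qed.

Lemma unstable_weight_derive (t s : R) : 0 <= t -> 0 <= s ->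
  is_derive_nonneg (fun r => - / lambda * Rpower (mu r / mu t) (- lambda)) s
    (Rpower (mu s / mu t) (- lambda) * (mu' s / mu s)).
Proof.
  intros Ht Hs.
  assert (H1 := mu_pos t Ht); assert (H2 := mu_pos s Hs).
  replace (Rpower (mu s / mu t) (- lambda) * (mu' s / mu s))
    with (mu' s * (Rpower (mu s / mu t) (- lambda) / mu s)) by (field; lra).
  apply (is_derive_nonneg_comp_real
    (fun m => - / lambda * Rpower (m / mu t) (- lambda)) mu); [easy| |now apply Hmu_deriv].
  unfold Rpower; auto_derive.
  - repeat split; try lra; now apply Rdiv_lt_0_compat.
  - unfold Rdiv; field; lra.
Qed.

(** [rho] is the size of [r] relative to the rate [mu' / (mu nu^d)]; [K] plays the integral of the
    pulled-back forcing, determined up to a constant. *)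
Definition forcing_primitive (rho : R) (K r : R -> E) : Prop :=
  0 <= rho /\ (forall s, 0 <= s -> is_derive_nonneg K s (T 0 s (r s))) /\
  (forall s, 0 <= s -> norm (r s) <= rho * mu' s / (mu s * Rpower (nu s) d)).

Lemma weighted_forcing_bound (rho w s n : R) :
  0 <= s -> 0 <= w -> n <= rho * mu' s / (mu s * Rpower (nu s) d) ->
  D * w * Rpower (nu s) d * n <= D * rho * (w * (mu' s / mu s)).
Proof.
  intros Hs Hw Hn.
  assert (Hmu := mu_pos s Hs); assert (Hnu := Rpower_pos (nu s) d).
  replace (D * rho * (w * (mu' s / mu s)))
    with (D * w * Rpower (nu s) d * (rho * mu' s / (mu s * Rpower (nu s) d)))
    by (field; lra).
  apply Rmult_le_compat_l; [|easy].
  repeat apply Rmult_le_pos; lra.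
Qed.

Lemma forcing_projection_derive (rho : R) (K r : R -> E) (i : index3) (t s : R) :
  forcing_primitive rho K r -> 0 <= t -> 0 <= s ->
  is_derive_nonneg (fun q => T t 0 (P i 0 (K q))) s (T t s (P i s (r s))).
Proof.
  intros (_ & HK & _) Ht Hs.
  rewrite <- evolution_projection_pullback by easy.
  apply (is_derive_nonneg_linear (fun v => T t 0 (P i 0 v))); [|easy|now apply HK].
  apply evolution_projection_linear; lra.
Qed.

Lemma stable_part_bound (rho : R) (K r : R -> E) (t : R) :
  forcing_primitive rho K r -> 0 <= t ->
  norm (T t 0 (P i1 0 (minus (K 0) (K t)))) <= D * rho / lambda.
Proof.
  intros HK Ht.
  assert (Hlin := evolution_projection_linear i1 t 0 Ht (Rle_refl 0)).
  rewrite (linear_minus _ _ _ Hlin), norm_minus_sym.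
  assert (H0 := Rpower_pos (mu t / mu 0) (- lambda)).
  eapply Rle_trans.
  - apply (norm_increment_le (fun s => T t 0 (P i1 0 (K s)))
      (fun s => T t s (P i1 s (r s)))
      (fun s => D * rho * (/ lambda * Rpower (mu t / mu s) (- lambda)))
      (fun s => D * rho * (Rpower (mu t / mu s) (- lambda) * (mu' s / mu s))));
      [lra| | |]; intros s Hs.
    + apply (forcing_projection_derive rho); easy || lra.
    + apply is_derive_nonneg_scal_real, stable_weight_derive; lra.
    + eapply Rle_trans; [now apply stable_bound|].
      apply weighted_forcing_bound; [lra | apply Rlt_le, Rpower_pos|].
      apply HK; lra.
  (* At [s = t] the primitive of the weight equals [/ lambda]; its value at 0 is positive and is
     dropped. *)
  - rewrite Rdiv_diag by (apply Rgt_not_eq, mu_pos, Ht).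
    rewrite Rpower_one_l.
    assert (Hrho : 0 <= D * rho * (/ lambda * Rpower (mu t / mu 0) (- lambda))).
    { assert (0 <= / lambda) by (apply Rlt_le, Rinv_0_lt_compat, Hlambda).
      destruct HK as [Hrho _]; repeat apply Rmult_le_pos; lra. }
    unfold Rdiv; lra.
Qed.

(** The weight decays in [s], so its mass on [[p, q]] is bounded by the value at [p] alone,
    uniformly in [q]. With [t = 0] this gives the Cauchy property at infinity, with [p = t] the
    bound on the unstable part. *)
Lemma unstable_increment_bound (rho : R) (K r : R -> E) (t p q : R) :
  forcing_primitive rho K r -> 0 <= t <= p -> p <= q ->
  norm (T t 0 (P i2 0 (minus (K q) (K p))))
    <= D * rho / lambda * Rpower (mu p / mu t) (- lambda).
Proof.
  intros HK Ht Hpq.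
  assert (Ht0 : 0 <= t) by lra.
  assert (Hlin := evolution_projection_linear i2 t 0 Ht0 (Rle_refl 0)).
  rewrite (linear_minus _ _ _ Hlin).
  assert (Hq := Rpower_pos (mu q / mu t) (- lambda)).
  eapply Rle_trans.
  - apply (norm_increment_le (fun s => T t 0 (P i2 0 (K s)))
      (fun s => T t s (P i2 s (r s)))
      (fun s => D * rho * (- / lambda * Rpower (mu s / mu t) (- lambda)))
      (fun s => D * rho * (Rpower (mu s / mu t) (- lambda) * (mu' s / mu s))));
      [lra| | |]; intros s Hs.
    + apply (forcing_projection_derive rho); easy || lra.
    + apply is_derive_nonneg_scal_real, unstable_weight_derive; lra.
    + eapply Rle_trans; [apply unstable_bound; lra|].
      apply weighted_forcing_bound; [lra | apply Rlt_le, Rpower_pos|].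
      apply HK; lra.
  - assert (Hrho : 0 <= D * rho * (/ lambda * Rpower (mu q / mu t) (- lambda))).
    { assert (0 <= / lambda) by (apply Rlt_le, Rinv_0_lt_compat, Hlambda).
      destruct HK as [Hrho _]; repeat apply Rmult_le_pos; lra. }
    unfold Rdiv; lra.
Qed.

Lemma Rpower_opp_le (x y : R) : 0 < x <= y -> Rpower y (- lambda) <= Rpower x (- lambda).
Proof.
  intros Hxy; rewrite !Rpower_Ropp.
  apply Rinv_le_contravar; [apply Rpower_pos|].
  apply Rle_Rpower_l; lra.
Qed.

Lemma mu_decay (eps : R) : 0 < eps ->
  exists M, forall s, M < s -> 0 <= s /\ Rpower (mu s) (- lambda) <= eps.
Proof.
  intros Heps.
  (* [B] is the solution of [B^(-lambda) = eps]. *)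
  set (B := Rpower eps (- / lambda)).
  assert (HB : Rpower B (- lambda) = eps).
  { unfold B; rewrite Rpower_mult.
    replace (- / lambda * - lambda) with 1 by (field; lra).
    now apply Rpower_1. }
  destruct (proj2 (is_lim_spec _ _ _) Hmu_lim B) as [M HM].
  exists (Rmax 0 M); intros s Hs.
  assert (H0 := Rmax_l 0 M); assert (H1 := Rmax_r 0 M).
  split; [lra|].
  rewrite <- HB; apply Rpower_opp_le; split; [apply Rpower_pos|].
  apply Rlt_le, HM; lra.
Qed.

(** Kept as a relation so that the difference of two limits can serve as the limit for the
    difference of two primitives. *)
Definition is_unstable_limit (K : R -> E) (l : E) : Prop :=
  forall eps, 0 < eps -> exists M, forall t, M < t -> norm (minus (P i2 0 (K t)) l) <= eps.

Definition unstable_limit (K : R -> E) : E := limit_at_infty (fun t => P i2 0 (K t)).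

Lemma unstable_limit_spec (rho : R) (K r : R -> E) :
  forcing_primitive rho K r -> is_unstable_limit K (unstable_limit K).
Proof.
  intros HK; refine (@limit_at_infty_spec X (fun t => P i2 0 (K t)) _).
  intros eps Heps.
  set (C := D * rho / lambda).
  assert (HC : 0 <= C).
  { destruct HK as [Hrho _]; apply Rdiv_le_0_compat; [apply Rmult_le_pos|]; lra. }
  destruct (mu_decay (eps / (C + 1))) as [M HM]; [apply Rdiv_lt_0_compat; lra|].
  exists M; intros s t Hs Hst.
  destruct (HM s Hs) as [Hs0 Hdecay].
  assert (H := unstable_increment_bound rho K r 0 s t HK (conj (Rle_refl 0) Hs0) Hst).
  rewrite (evolution_id A T HT), (linear_minus _ _ _ (projection_linear i2 0 (Rle_refl 0)))
    in H by lra.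
  eapply Rle_trans; [exact H|]; fold C.
  rewrite Hmu_0, Rdiv_1_r.
  assert (Hpos := Rpower_pos (mu s) (- lambda)).
  replace eps with ((C + 1) * (eps / (C + 1))) by (field; lra).
  apply Rmult_le_compat; lra.
Qed.

Lemma unstable_part_bound (rho : R) (K r : R -> E) (l : E) (t : R) :
  forcing_primitive rho K r -> is_unstable_limit K l -> 0 <= t ->
  norm (T t 0 (minus l (P i2 0 (K t)))) <= D * rho / lambda.
Proof.
  intros HK Hl Ht; apply norm_le_of_eps; intros eps Heps.
  assert (Hlin := evolution_linear A T HA HT t 0 Ht (Rle_refl 0)).
  destruct (linear_norm _ Hlin) as (N & HN & Hbound).
  destruct (Hl (eps / N)) as [M HM]; [now apply Rdiv_lt_0_compat|].
  set (q := Rmax t M + 1).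
  assert (Hq : t <= q /\ M < q).
  { assert (H1 := Rmax_l t M); assert (H2 := Rmax_r t M); unfold q; lra. }
  (* The limit is approached at a late time [q]: the increment from [t] to [q] has a bound free of
     [q], and the error left at [q] stays below [eps] after applying the fixed operator [T t 0], of
     bound [N]. *)
  replace (minus l (P i2 0 (K t)))
    with (plus (P i2 0 (minus (K q) (K t))) (minus l (P i2 0 (K q)))).
  2:{ rewrite (linear_minus _ _ _ (projection_linear i2 0 (Rle_refl 0))); vring E. }
  rewrite (linear_plus _ Hlin).
  eapply Rle_trans; [apply norm_triangle|]; apply Rplus_le_compat.
  - assert (H := unstable_increment_bound rho K r t t q HK).
    rewrite Rdiv_diag, Rpower_one_l, Rmult_1_r in H by (apply Rgt_not_eq, mu_pos, Ht).
    apply H; lra.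
  - eapply Rle_trans; [apply Hbound|].
    rewrite norm_minus_sym.
    replace eps with (N * (eps / N)) by (field; lra).
    apply Rmult_le_compat_l; [lra | now apply HM].
Qed.

(** For [K' t = T 0 t (r t)] and [l = lim P2(0) K], this solves
    [w' = A w - (P1 + P2) r]; its [P1]-part vanishes at [0], its [P2]-part is
    bounded and its [P3]-part is zero. *)
Definition bounded_response (K : R -> E) (l : E) (t : R) : E :=
  T t 0 (plus (P i1 0 (minus (K 0) (K t))) (minus l (P i2 0 (K t)))).

Lemma bounded_response_bound (rho : R) (K r : R -> E) (l : E) (t : R) :
  forcing_primitive rho K r -> is_unstable_limit K l -> 0 <= t ->
  norm (bounded_response K l t) <= 2 * D * rho / lambda.
Proof.
  intros HK Hl Ht; unfold bounded_response.
  rewrite (linear_plus _ (evolution_linear A T HA HT t 0 Ht (Rle_refl 0))).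
  eapply Rle_trans; [apply norm_triangle|].
  assert (H1 := stable_part_bound rho K r t HK Ht).
  assert (H2 := unstable_part_bound rho K r l t HK Hl Ht).
  unfold Rdiv in *; lra.
Qed.

(** The response is linear in the pair [(K, l)], so the difference of two responses is the response
    to [r1 - r2], whose weighted size is [rho]. *)
Lemma bounded_response_lipschitz (rho1 rho2 rho : R) (K1 r1 K2 r2 : R -> E) (t : R) :
  forcing_primitive rho1 K1 r1 -> forcing_primitive rho2 K2 r2 -> 0 <= rho ->
  (forall s, 0 <= s ->
     norm (minus (r1 s) (r2 s)) <= rho * mu' s / (mu s * Rpower (nu s) d)) ->
  0 <= t ->
  norm (minus (bounded_response K1 (unstable_limit K1) t)
              (bounded_response K2 (unstable_limit K2) t)) <= 2 * D * rho / lambda.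
Proof.
  intros HK1 HK2 Hrho Hr Ht.
  set (K := fun s => minus (K1 s) (K2 s)).
  set (l := minus (unstable_limit K1) (unstable_limit K2)).
  assert (HK : forcing_primitive rho K (fun s => minus (r1 s) (r2 s))).
  { split; [easy|]; split; [|easy]; intros s Hs.
    rewrite (linear_minus _ _ _ (evolution_linear A T HA HT 0 s (Rle_refl 0) Hs)).
    apply is_derive_nonneg_minus; [now apply HK1 | now apply HK2]. }
  assert (HP := fun i => projection_linear i 0 (Rle_refl 0)).
  assert (Hl : is_unstable_limit K l).
  { intros eps Heps.
    destruct (unstable_limit_spec _ _ _ HK1 (eps / 2)) as [M1 H1]; [lra|].
    destruct (unstable_limit_spec _ _ _ HK2 (eps / 2)) as [M2 H2]; [lra|].
    exists (Rmax M1 M2); intros s Hs.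
    assert (Hs1 := Rmax_l M1 M2); assert (Hs2 := Rmax_r M1 M2).
    specialize (H1 s ltac:(lra)); specialize (H2 s ltac:(lra)).
    unfold K, l; rewrite (linear_minus _ _ _ (HP i2)).
    replace (minus (minus (P i2 0 (K1 s)) (P i2 0 (K2 s)))
                   (minus (unstable_limit K1) (unstable_limit K2)))
      with (minus (minus (P i2 0 (K1 s)) (unstable_limit K1))
                  (minus (P i2 0 (K2 s)) (unstable_limit K2))) by vring E.
    eapply Rle_trans; [apply norm_minus_le|]; lra. }
  replace (minus _ _) with (bounded_response K l t).
  - exact (bounded_response_bound rho K _ l t HK Hl Ht).
  - unfold bounded_response, K, l.
    rewrite <- (linear_minus _ _ _ (evolution_linear A T HA HT t 0 Ht (Rle_refl 0))).
    f_equal; rewrite !(linear_minus _ _ _ (HP i1)), (linear_minus _ _ _ (HP i2)).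
    vring E.
Qed.

Lemma bounded_response_derive (rho : R) (K r : R -> E) (l : E) (t : R) :
  forcing_primitive rho K r -> 0 <= t ->
  is_derive_nonneg (bounded_response K l) t
    (minus (A t (bounded_response K l t)) (minus (r t) (P i3 t (r t)))).
Proof.
  intros (_ & HK & _) Ht.
  assert (HP := fun i => projection_linear i 0 (Rle_refl 0)).
  assert (HTl := evolution_linear A T HA HT t 0 Ht (Rle_refl 0)).
  set (k := T 0 t (r t)).
  set (u' := plus (P i1 0 (minus (@zero E) k)) (minus (@zero E) (P i2 0 k))).
  replace (minus (A t (bounded_response K l t)) (minus (r t) (P i3 t (r t))))
    with (plus (A t (bounded_response K l t)) (T t 0 u')).
  - apply (evolution_pushforward_derive A T HA HT
      (fun s => plus (P i1 0 (minus (K 0) (K s))) (minus l (P i2 0 (K s))))); [easy|].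
    apply is_derive_nonneg_plus.
    + apply is_derive_nonneg_linear; [apply HP | easy |].
      apply is_derive_nonneg_minus; [apply is_derive_nonneg_const | now apply HK].
    + apply is_derive_nonneg_minus; [apply is_derive_nonneg_const|].
      apply is_derive_nonneg_linear; [apply HP | easy | now apply HK].
  - unfold u'; rewrite (linear_minus _ _ _ (HP i1)), (linear_zero _ (HP i1)).
    rewrite (linear_plus _ HTl), !(linear_minus _ _ _ HTl), (linear_zero _ HTl).
    unfold k; rewrite !evolution_projection_pullback by easy.
    rewrite !(evolution_id A T HT) by easy.
    rewrite <- (HP_sum t (r t) Ht) at 3; vring E.
Qed.

(** By invariance it suffices to look at time 0, where [P i3 0] kills the ranges of the other two
    projections and, being bounded, also the limit [unstable_limit K] of vectors in the range of
    [P i2 0]. *)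
Lemma bounded_response_center (rho : R) (K r : R -> E) (t : R) :
  forcing_primitive rho K r -> 0 <= t ->
  P i3 t (bounded_response K (unstable_limit K) t) = zero.
Proof.
  intros HK Ht.
  assert (HP := fun i => projection_linear i 0 (Rle_refl 0)).
  assert (HTl := evolution_linear A T HA HT t 0 Ht (Rle_refl 0)).
  unfold bounded_response; rewrite <- HP_inv by lra.
  rewrite (linear_plus _ (HP i3)), (linear_minus _ _ _ (HP i3)).
  rewrite !HP_orth by (easy || lra).
  enough (P i3 0 (unstable_limit K) = zero) as ->.
  { transitivity (T t 0 zero); [f_equal; vring E | now apply linear_zero]. }
  apply norm_eq_zero, Rle_antisym; [|apply norm_ge_0].
  apply norm_le_of_eps; intros eps Heps.
  destruct (linear_norm _ (HP i3)) as (N & HN & Hbound).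
  destruct (unstable_limit_spec _ _ _ HK (eps / N)) as [M HM];
    [now apply Rdiv_lt_0_compat|].
  specialize (HM (M + 1) ltac:(lra)).
  replace (P i3 0 (unstable_limit K))
    with (P i3 0 (minus (unstable_limit K) (P i2 0 (K (M + 1))))).
  2:{ rewrite (linear_minus _ _ _ (HP i3)), HP_orth by (easy || lra); vring E. }
  rewrite Rplus_0_l; eapply Rle_trans; [apply Hbound|].
  rewrite norm_minus_sym.
  replace eps with (N * (eps / N)) by (field; lra).
  apply Rmult_le_compat_l; lra.
Qed.

(** * The nonlinear correction as a fixed point *)

Variables (f : R -> E -> E) (c : R).
Hypotheses
  (Hf : continuous_on (fun p : R * E => 0 <= fst p)
          (fun p : R * E => f (fst p) (snd p)))
  (Hc : 0 <= c)
  (Hlip : forall t u v, 0 <= t ->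
     norm (minus (f t u) (f t v))
       <= c * mu' t / (mu t * Rpower (nu t) d) * norm (minus u v)).

Lemma nonlinearity_continuous (g : R -> E) :
  continuous_on (Rle 0) g -> continuous_on (Rle 0) (fun s => f s (g s)).
Proof.
  intros Hg t Ht Q HQ.
  destruct (Hf (t, g t) Ht Q HQ) as [eps Heps].
  assert (H1 : within (Rle 0) (locally t) (fun s => ball (g t) eps (g s)))
    by exact (Hg t Ht _ (locally_ball (g t) eps)).
  assert (H2 : within (Rle 0) (locally t) (fun s => ball t eps s))
    by (apply filter_le_within, locally_ball).
  assert (H3 : within (Rle 0) (locally t) (fun s => 0 <= s))
    by (exists eps; easy).
  change (within (Rle 0) (locally t) (fun s => Q (f s (g s)))).
  generalize (filter_and _ _ H1 (filter_and _ _ H2 H3)); apply filter_imp.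
  intros s (Hs1 & Hs2 & Hs3).
  apply (Heps (s, g s)); [now split | easy].
Qed.

Section Correction.

Variables (y y' : R -> E) (delta : R).
Hypotheses
  (Hdelta : 0 < delta)
  (Hsmall : 2 * c * D / lambda < 1)
  (Hy : forall t, 0 <= t -> is_derive_nonneg y t (y' t))
  (Happrox : forall t, 0 <= t ->
     norm (minus (minus (y' t) (A t (y t))) (f t (y t)))
       <= delta * mu' t / (mu t * Rpower (nu t) d)).

Definition defect (z : R -> E) (t : R) : E :=
  minus (minus (y' t) (A t (y t))) (f t (plus (y t) (z t))).

(** An antiderivative of [T 0 s (defect z s)]: only the continuous term is
    integrated, because [y'] need not be integrable. *)
Definition defect_primitive (z : R -> E) (t : R) : E :=
  minus (T 0 t (y t))
    (RInt (fun s => (fun r => T 0 r (f r (plus (y r) (z r)))) (Rmax 0 s) : X) 0 t).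

Definition correction_step (z : R -> E) : R -> E :=
  bounded_response (defect_primitive z) (unstable_limit (defect_primitive z)).

(** Read off from the bound on [y]: [delta] times this rate dominates a norm. *)
Lemma rate_nonneg (t : R) : 0 <= t -> 0 <= mu' t / (mu t * Rpower (nu t) d).
Proof.
  intros Ht; apply Rmult_le_reg_l with delta; [easy|].
  rewrite Rmult_0_r.
  eapply Rle_trans; [exact (Rle_trans _ _ _ (norm_ge_0 _) (Happrox t Ht))|].
  right; unfold Rdiv; ring.
Qed.

Lemma nonlinearity_lipschitz (z w : R -> E) (rho t : R) :
  0 <= t -> norm (minus (z t) (w t)) <= rho ->
  norm (minus (f t (plus (y t) (z t))) (f t (plus (y t) (w t))))
    <= c * rho * mu' t / (mu t * Rpower (nu t) d).
Proof.
  intros Ht Hzw.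
  eapply Rle_trans; [now apply Hlip|].
  replace (minus (plus (y t) (z t)) (plus (y t) (w t))) with (minus (z t) (w t))
    by vring E.
  assert (Hr := rate_nonneg t Ht).
  replace (c * rho * mu' t / (mu t * Rpower (nu t) d))
    with (c * (mu' t / (mu t * Rpower (nu t) d)) * rho) by (unfold Rdiv; ring).
  replace (c * mu' t / (mu t * Rpower (nu t) d))
    with (c * (mu' t / (mu t * Rpower (nu t) d))) by (unfold Rdiv; ring).
  apply Rmult_le_compat_l; [now apply Rmult_le_pos | easy].
Qed.

(** The defect for [z = 0] is the error of [y], of size [delta]; passing to [z] changes only [f],
    which costs [c * rho]. *)
Lemma defect_bound (z : R -> E) (rho t : R) :
  0 <= t -> norm (z t) <= rho ->
  norm (defect z t) <= (delta + c * rho) * mu' t / (mu t * Rpower (nu t) d).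
Proof.
  intros Ht Hz.
  replace (defect z t) with (plus (defect (fun _ => zero) t)
    (minus (f t (plus (y t) zero)) (f t (plus (y t) (z t)))))
    by (unfold defect; vring E).
  eapply Rle_trans; [apply norm_triangle|].
  replace ((delta + c * rho) * mu' t / (mu t * Rpower (nu t) d))
    with (delta * mu' t / (mu t * Rpower (nu t) d)
          + c * rho * mu' t / (mu t * Rpower (nu t) d)) by (unfold Rdiv; ring).
  apply Rplus_le_compat.
  - unfold defect; rewrite plus_zero_r; now apply Happrox.
  - apply (nonlinearity_lipschitz (fun _ => zero) z); [easy|].
    rewrite norm_minus_sym; cbv beta.
    now replace (minus (z t) _) with (z t) by vring E.
Qed.

Lemma defect_forcing (z : R -> E) (rho : R) :
  0 <= rho -> continuous_on (Rle 0) z -> (forall t, 0 <= t -> norm (z t) <= rho) ->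
  forcing_primitive (delta + c * rho) (defect_primitive z) (defect z).
Proof.
  intros Hrho Hz Hzr; split; [|split].
  - assert (0 <= c * rho) by now apply Rmult_le_pos.
    lra.
  - intros t Ht.
    assert (Hyz : continuous_on (Rle 0) (fun s => plus (y s) (z s))).
    { intros s Hs.
      apply (filterlim_comp_2 (G := locally (y s)) (H := locally (z s))).
      - exact (is_derive_nonneg_continuous y y' Hy s Hs).
      - exact (Hz s Hs).
      - apply (@filterlim_plus R_AbsRing E). }
    unfold defect_primitive, defect.
    rewrite (linear_minus _ _ _ (evolution_linear A T HA HT 0 t (Rle_refl 0) Ht)).
    apply is_derive_nonneg_minus.
    + apply (evolution_pullback_derive A T HA HT); [easy | now apply Hy].
    + apply (@is_derive_nonneg_RInt X
        (fun r => T 0 r (f r (plus (y r) (z r))))); [easy|].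
      apply (evolution_pullback_continuous A T HA HT).
      now apply nonlinearity_continuous.
  - intros t Ht; apply defect_bound; auto.
Qed.

Lemma correction_exists :
  exists z z' : R -> E,
    (forall t, 0 <= t -> is_derive_nonneg z t (z' t)) /\
    (forall t, 0 <= t -> P i3 t (z t) = zero) /\
    (forall t, 0 <= t ->
       norm (z t) <= 2 * D / lambda / (1 - 2 * c * D / lambda) * delta) /\
    (forall t, 0 <= t ->
       z' t = minus (A t (z t)) (minus (defect z t) (P i3 t (defect z t)))).
Proof.
  set (k := 2 * c * D / lambda) in *.
  assert (Hk : 0 <= k).
  { apply Rdiv_le_0_compat; [repeat apply Rmult_le_pos|]; lra. }
  (* The radius solves [rho = 2 D (delta + c rho) / lambda], so the step maps the ball of radius
     [rho] into itself; this is [Hball]. *)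
  set (rho := 2 * D / lambda / (1 - k) * delta).
  assert (Hrho : 0 <= rho).
  { unfold rho; apply Rmult_le_pos; [|lra].
    repeat apply Rdiv_le_0_compat; lra. }
  assert (Hball : 2 * D * (delta + c * rho) / lambda = rho).
  { replace (2 * D * (delta + c * rho) / lambda)
      with (2 * D * delta / lambda + k * rho) by (unfold k; field; lra).
    unfold rho; field; lra. }
  set (adm := fun z : R -> E =>
    continuous_on (Rle 0) z /\ forall t, 0 <= t -> norm (z t) <= rho).
  assert (Hforcing : forall z, adm z ->
    forcing_primitive (delta + c * rho) (defect_primitive z) (defect z)).
  { intros z [Hz Hzr]; now apply defect_forcing. }
  assert (Hbound : forall z t, adm z -> 0 <= t -> norm (correction_step z t) <= rho).
  { intros z t Hz Ht; rewrite <- Hball.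
    apply (bounded_response_bound _ _ (defect z)); [now apply Hforcing| |easy].
    now apply (unstable_limit_spec (delta + c * rho) _ (defect z)), Hforcing. }
  assert (Hderive : forall z t, adm z -> 0 <= t ->
    is_derive_nonneg (correction_step z) t
      (minus (A t (correction_step z t)) (minus (defect z t) (P i3 t (defect z t))))).
  { intros z t Hz Ht.
    now apply (bounded_response_derive (delta + c * rho)); [apply Hforcing|]. }
  assert (Hadm0 : adm (fun _ => zero)).
  { split.
    - apply (is_derive_nonneg_continuous _ (fun _ => zero)); intros t Ht.
      apply is_derive_nonneg_const.
    - intros t Ht; rewrite norm_zero; easy. }
  destruct (contraction_fixed_point adm correction_step (fun _ => zero) k rho)
    as (z & Hz & Hfix); [lra | easy | easy | | | | |].
  - intros z Hz; split.
    + exact (is_derive_nonneg_continuous _ _ (fun t => Hderive z t Hz)).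
    + intros t Ht; now apply Hbound.
  - intros u z Hu Hlim; split.
    + apply continuous_on_nonneg_iff; intros t Ht eps Heps.
      destruct (Hlim (eps / 3)) as [n Hn]; [lra|].
      destruct (proj1 (continuous_on_nonneg_iff (u n)) (proj1 (Hu n)) t Ht (eps / 3))
        as (eta & Heta & H); [lra|].
      exists eta; split; [easy|]; intros s Hs Hst.
      specialize (H s Hs Hst).
      assert (H1 := Hn s Hs); assert (H2 := Hn t Ht).
      rewrite norm_minus_sym in H1.
      assert (H3 := norm_minus_triangle (z s) (u n s) (z t)).
      assert (H4 := norm_minus_triangle (u n s) (u n t) (z t)).
      lra.
    + intros t Ht; apply norm_le_of_eps; intros eps Heps.
      destruct (Hlim eps Heps) as [n Hn].
      assert (H1 := Hn t Ht); rewrite norm_minus_sym in H1.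
      assert (H2 := proj2 (Hu n) t Ht).
      assert (H3 := norm_le_plus_minus (z t) (u n t)).
      lra.
  (* The iteration starts at zero, so its first displacement is a value of the step and is bounded
     by [rho]. *)
  - intros t Ht.
    replace (minus _ _)
      with (correction_step (fun _ => zero) t) by vring E.
    now apply Hbound.
  - intros z w r Hz Hw Hzw t Ht.
    assert (Hr : 0 <= r) by exact (Rle_trans _ _ _ (norm_ge_0 _) (Hzw t Ht)).
    replace (k * r) with (2 * D * (c * r) / lambda) by (unfold k; field; lra).
    apply (bounded_response_lipschitz (delta + c * rho) (delta + c * rho) (c * r)
      (defect_primitive z) (defect z) (defect_primitive w) (defect w));
      [now apply Hforcing | now apply Hforcing | now apply Rmult_le_pos | | easy].
    intros s Hs; unfold defect.
    replace (minus (minus _ _) (minus _ _))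
      with (minus (f s (plus (y s) (w s))) (f s (plus (y s) (z s)))) by vring E.
    rewrite norm_minus_sym; now apply nonlinearity_lipschitz; [|apply Hzw].
  - exists z, (fun t => minus (A t (z t)) (minus (defect z t) (P i3 t (defect z t)))).
    split; [|split; [|split]].
    + intros t Ht.
      apply (is_derive_nonneg_ext (correction_step z)); [easy | exact Hfix |].
      rewrite <- (Hfix t Ht) at 1; now apply Hderive.
    + intros t Ht; rewrite <- (Hfix t Ht).
      now apply (bounded_response_center (delta + c * rho) _ (defect z));
        [apply Hforcing|].
    + intros t Ht; now apply Hz.
    + easy.
Qed.

End Correction.

(** * Shadowing with explicit constants *)

Hypotheses
  (Hnu : forall t, 0 <= t -> 1 <= nu t)
  (Hd : 0 <= d)
  (Hq : c * (2 * D + 1) + 2 * c * D * / lambda < 1).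

Lemma conditional_shadowing :
  exists C : R, 0 < C /\
    forall (delta : R) (y y' : R -> E),
      0 < delta ->
      (forall t, 0 <= t -> is_derive_nonneg y t (y' t)) ->
      (forall t, 0 <= t ->
         norm (minus (minus (y' t) (A t (y t))) (f t (y t)))
           <= delta * mu' t / (mu t * Rpower (nu t) d)) ->
      exists x x' : R -> E,
        (forall t, 0 <= t -> is_derive_nonneg x t (x' t)) /\
        (forall t, 0 <= t -> P i3 t (minus (x t) (y t)) = zero) /\
        (forall t, 0 <= t -> norm (minus (x t) (y t)) <= C * delta) /\
        (forall t, 0 <= t -> exists w : E,
           minus (minus (x' t) (A t (x t))) (f t (x t)) = P i3 t w) /\
        (forall t, 0 <= t ->
           norm (minus (minus (x' t) (A t (x t))) (f t (x t)))
             <= C * delta * (2 * D + 1) * Rpower (nu t) d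
                * Rmax 1 (mu' t / mu t)).
Proof.
  (* The contraction constant is one of the two nonnegative summands of [q]. *)
  assert (Hsmall : 2 * c * D / lambda < 1).
  { assert (0 <= c * (2 * D + 1)) by (apply Rmult_le_pos; lra).
    unfold Rdiv; lra. }
  set (B := 2 * D / lambda / (1 - 2 * c * D / lambda)).
  assert (HB : 0 <= B) by (repeat apply Rdiv_le_0_compat; lra).
  assert (HcB : 0 <= c * B) by now apply Rmult_le_pos.
  (* [B * delta] bounds [x - y], and [(1 + c * B) * delta] is the weighted size of the defect; the
     sum dominates both and is positive. *)
  exists (1 + c * B + B); split; [lra|].
  intros delta y y' Hdelta Hy Happrox.
  destruct (correction_exists y y' delta Hdelta Hsmall Hy Happrox)
    as (z & z' & Hz & Hcenter & Hbound & Hz').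
  fold B in Hbound.
  (* Adding [z' - A z = -(r - P3 r)] to the defect [r] leaves exactly [P3 r], which yields (iii) and
     reduces (iv) to bounds on [P3] and [r]. *)
  assert (Hdefect : forall t, 0 <= t ->
    minus (minus (plus (y' t) (z' t)) (A t (plus (y t) (z t)))) (f t (plus (y t) (z t)))
      = P i3 t (defect y y' z t)).
  { intros t Ht; rewrite Hz' by easy.
    rewrite (linear_plus _ (proj1 HA t Ht)); unfold defect at 1; vring E. }
  assert (Hxy : forall t, minus (plus (y t) (z t)) (y t) = z t)
    by (intros t; vring E).
  exists (fun t => plus (y t) (z t)), (fun t => plus (y' t) (z' t)).
  split; [|split; [|split; [|split]]]; intros t Ht.
  - now apply is_derive_nonneg_plus; [apply Hy | apply Hz].
  - now rewrite Hxy; apply Hcenter.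
  - rewrite Hxy; eapply Rle_trans; [now apply Hbound|].
    apply Rmult_le_compat_r; lra.
  - now exists (defect y y' z t); apply Hdefect.
  - rewrite Hdefect by easy.
    assert (Hn : 1 <= Rpower (nu t) d).
    { rewrite <- (Rpower_one_l d); apply Rle_Rpower_l; [easy|].
      specialize (Hnu t Ht); lra. }
    assert (Hmu := mu_pos t Ht).
    assert (Hdef := defect_bound y y' delta Hdelta Happrox z (B * delta) t Ht
      (Hbound t Ht)).
    assert (Hrate := rate_nonneg y y' delta Hdelta Happrox t Ht).
    set (n := Rpower (nu t) d) in *.
    set (q := mu' t / mu t).
    assert (Hq0 : 0 <= q).
    { replace q with (n * (mu' t / (mu t * n))) by (unfold q; field; lra).
      apply Rmult_le_pos; lra. }
    assert (Hmax : q <= n * Rmax 1 q).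
    { assert (H1 := Rmax_l 1 q); assert (H2 := Rmax_r 1 q).
      rewrite <- (Rmult_1_l q) at 1; apply Rmult_le_compat; lra. }
    assert (H2D : 1 + 2 * D * n <= (2 * D + 1) * n) by lra.
    eapply Rle_trans; [now apply center_projection_bound|]; fold n.
    eapply Rle_trans; [apply Rmult_le_compat; [| |exact H2D | exact Hdef]|].
    + assert (0 <= D * n) by (apply Rmult_le_pos; lra); lra.
    + apply norm_ge_0.
    (* The [n] from the bound on [P3] cancels the weight of the defect and leaves the bare rate [q],
       which [Hmax] compares with [n * Rmax 1 q]. *)
    + replace ((2 * D + 1) * n * ((delta + c * (B * delta)) * mu' t / (mu t * n)))
        with ((1 + c * B) * (delta * (2 * D + 1)) * q)
        by (unfold q; field; lra).
      replace ((1 + c * B + B) * delta * (2 * D + 1) * n * Rmax 1 q)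
        with ((1 + c * B + B) * (delta * (2 * D + 1)) * (n * Rmax 1 q)) by ring.
      assert (0 <= delta * (2 * D + 1)) by (apply Rmult_le_pos; lra).
      apply Rmult_le_compat; [apply Rmult_le_pos; lra | easy | | easy].
      apply Rmult_le_compat_r; lra.
Qed.

End Dichotomy.

Theorem theorem3p1 (X : CompleteNormedModule R_AbsRing)
    (A : R -> X -> X) (T : R -> R -> X -> X) (f : R -> X -> X)
    (mu mu' nu : R -> R) (P : index3 -> R -> X -> X)
    (D lambda d c : R)
    (HA : continuous_operators A)
    (HT : is_evolution_family A T)
    (Hf : continuous_on (fun p : R * X => 0 <= fst p)
            (fun p : R * X => f (fst p) (snd p)))
    (Hmu_incr : forall s t, 0 <= s -> s < t -> mu s < mu t)
    (Hmu_deriv : forall t, 0 <= t -> is_derive_nonneg mu t (mu' t))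
    (Hmu_0 : mu 0 = 1)
    (Hmu_lim : is_lim mu p_infty p_infty)
    (Hnu : forall t, 0 <= t -> 1 <= nu t)
    (HP_proj : forall i t, 0 <= t -> is_projection (P i t))
    (HP_sum : forall t v, 0 <= t ->
       plus (plus (P i1 t v) (P i2 t v)) (P i3 t v) = v)
    (HP_orth : forall i j t v, 0 <= t -> i <> j -> P i t (P j t v) = zero)
    (HP_inv : forall i t s v, 0 <= t -> 0 <= s ->
       T t s (P i s v) = P i t (T t s v))
    (HD : 0 < D) (Hlambda : 0 < lambda) (Hd : 0 <= d)
    (Hdich1 : forall t s, 0 <= s -> s <= t ->
       opnorm (fun v => T t s (P i1 s v))
         <= D * Rpower (mu t / mu s) (- lambda) * Rpower (nu s) d)
    (Hdich2 : forall t s, 0 <= t -> t <= s ->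
       opnorm (fun v => T t s (P i2 s v))
         <= D * Rpower (mu s / mu t) (- lambda) * Rpower (nu s) d)
    (Hc : 0 <= c)
    (Hlip : forall t u v, 0 <= t ->
       norm (minus (f t u) (f t v))
         <= c * mu' t / (mu t * Rpower (nu t) d) * norm (minus u v))
    (Hq : c * (2 * D + 1) + 2 * c * D * / lambda < 1) :
  exists C : R, 0 < C /\
    forall (delta : R) (y y' : R -> X),
      0 < delta ->
      (forall t, 0 <= t -> is_derive_nonneg y t (y' t)) ->
      (forall t, 0 <= t ->
         norm (minus (minus (y' t) (A t (y t))) (f t (y t)))
           <= delta * mu' t / (mu t * Rpower (nu t) d)) ->
      exists x x' : R -> X,
        (forall t, 0 <= t -> is_derive_nonneg x t (x' t)) /\
        (forall t, 0 <= t -> P i3 t (minus (x t) (y t)) = zero) /\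
        Rbar_le
          (Lub_Rbar (fun r => exists t, 0 <= t /\ r = norm (minus (x t) (y t))))
          (Finite (C * delta)) /\
        (forall t, 0 <= t -> exists w : X,
           minus (minus (x' t) (A t (x t))) (f t (x t)) = P i3 t w) /\
        (forall t, 0 <= t ->
           norm (minus (minus (x' t) (A t (x t))) (f t (x t)))
             <= C * delta * (2 * D + 1) * Rpower (nu t) d
                * Rmax 1 (mu' t / mu t)).
Proof.
  destruct (@conditional_shadowing X A T mu mu' nu P D lambda d HA HT Hmu_incr
    Hmu_deriv Hmu_0 Hmu_lim HP_proj HP_sum HP_orth HP_inv HD Hlambda Hdich1 Hdich2
    f c Hf Hc Hlip Hnu Hd Hq) as (C & HC & H).
  exists C; split; [easy|]; intros delta y y' Hdelta Hy Happrox.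
  destruct (H delta y y' Hdelta Hy Happrox) as (x & x' & H1 & H2 & H3 & H4 & H5).
  exists x, x'; split; [easy | split; [easy | split; [|easy]]].
  apply Lub_Rbar_correct; intros r (t & Ht & ->); now apply H3.
Qed.
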